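(* Let $W$ be a finite Coxeter group with standard Coxeter element $c$ and fixed $c$-compatible reflection ordering $\prec$; let $\mathcal{P}=\mathcal{A}^!$ with generators $x_t$ and, for a face $f=\{u_1\succ\dots\succ u_j\}$ of $\Delta^+$, $x_f=x_{u_1}\cdots x_{u_j}$. Let $t_1,\dots,t_j\in T$ with $w=t_1\cdots t_j\in NC_j$. Let $\gamma(t_1,\dots,t_j)=\operatorname{Span}_{\mathbb{R}_{\ge0}}\{\rho(t_1),\dots,\rho(t_j)\}$, let $M=\operatorname{Span}_{\mathbb{R}}\{\rho(t_1),\dots,\rho(t_j)\}$ oriented so that $(\rho(t_1),\dots,\rho(t_j))$ is a positive basis, and for $f\in\Delta^+$ let $\gamma(f)=\operatorname{Span}_{\mathbb{R}_{\ge0}}\{\rho(u):u\in f\}$. For $f=\{u_1\succ\dots\succ u_j\}\in\Delta^+$ with $\operatorname{nc}(f)=w$, let $\omega(f)=1$ if $(\rho(u_1),\dots,\rho(u_j))$ is a positively oriented basis of $M$ and $\omega(f)=-1$ otherwise. Let \[X(t_1,\dots,t_j)=\{f\in\Delta^+:\operatorname{nc}(f)=w,\ \gamma(f)\subset\gamma(t_1,\dots,t_j)\}.\] Then the cones $\gamma(f)$, $f\in X(t_1,\dots,t_j)$, are the maximal cones of a simplicial fan with support $\gamma(t_1,\dots,t_j)$, and \[x_{t_1}\cdots x_{t_j}=\sum_{f\in X(t_1,\dots,t_j)}\omega(f)\,x_f\quad\text{in }\mathcal{P}.\]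
   Context: $W$ acts on $\mathbb{R}^n$ as a reflection group; $T$ is its set of reflections and $\rho(t)$ the positive root of $t\in T$ (for a fixed generic positive half-space). $\ell_T$ is reflection length, $w\le_T z$ iff $\ell_T(w)+\ell_T(w^{-1}z)=\ell_T(z)$; $NC=[e,c]$, $NC_j$ its elements of length $j$; $c=s_1\cdots s_n$ is a product of the simple reflections. $\mathcal{A}=k[\mathbf{D}(W)]$ where $\mathbf{D}(W)$ has generators $\mathbf{t}$ and relations $\mathbf{t}\mathbf{u}=\mathbf{u}\mathbf{t}^{\mathbf{u}}$ for $tu\le_T c$ ($\mathbf{t}^{\mathbf{u}}\leftrightarrow utu$); $\mathcal{P}=\mathcal{A}^!$ is the quadratic dual with $(x_t)$ dual to $(\mathbf{t})$. A reflection ordering is a total order on $T$ such that for each rank 2 parabolic subgroup, with reflections $u_1,\dots,u_m$ indexed so that $u_{i+1}u_i=u_iu_{i-1}$ (mod $m$) and $u_1,u_m$ simple, they appear in order $u_1,\dots,u_m$ or its reverse; it is $c$-compatible if for each $w\in NC_2$ with $\{t\le_T w\}=\{u_1\prec\dots\prec u_m\}$, $w=u_iu_{i-1}$ for all $i$ ($u_0=u_m$). $\Delta^+$ is the simplicial complex whose facets are sets $\{t_1,\dots,t_n\}\subset T$ with $c=t_1\cdots t_n$ and $\langle\rho(t_i),\rho(t_j)\rangle\ge0$ ($i\neq j$); for a face $f$, $\operatorname{nc}(f)$ is the product of its elements taken in an order making the product lie in $NC_{\#f}$ (well defined). *)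

(* Defs.v *)
From HB Require Import structures.
From mathcomp Require Import all_boot all_order all_fingroup all_algebra.
From mathcomp Require Import all_character.
From mathcomp Require Import boolp classical_sets cardinality reals.
From mathcomp Require Import monalg.

Set Implicit Arguments.
Unset Strict Implicit.
Unset Printing Implicit Defensive.

Import Order.TTheory GRing.Theory Num.Theory.

Local Open Scope ring_scope.
Local Open Scope quotient_scope.

(* The quotient of a (non commutative) ring by the two-sided ideal generated  *)
(* by a set; ring_quotient.v only covers proper ideals of commutative rings.  *)
Section TwoSidedQuotient.
Variables (A : pzRingType) (S : set A).

Definition two_sided_ideal (J : set A) : Prop :=
  [/\ J 0, forall x y, J x -> J y -> J (x - y)
    & forall a x b, J x -> J (a * x * b)].

Definition ideal_gen : {pred A} :=
  fun x => `[< forall J, subset S J -> two_sided_ideal J -> J x >].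

Lemma ideal_gen_zmod_closed : zmod_closed ideal_gen.
Proof.
split=> [|x y /asboolP Jx /asboolP Jy]; apply/asboolP => J SJ idJ.
  by case: idJ.
by case: (idJ) => _ JB _; apply: JB; [apply: Jx|apply: Jy].
Qed.

HB.instance Definition _ :=
  GRing.isZmodClosed.Build A ideal_gen ideal_gen_zmod_closed.

Lemma ideal_genM a x b : x \in ideal_gen -> a * x * b \in ideal_gen.
Proof.
move=> /asboolP Jx; apply/asboolP => J SJ idJ.
by case: (idJ) => _ _; apply; apply: Jx.
Qed.

Definition ring_quot := Quotient.quot ideal_gen.

HB.instance Definition _ := GRing.Zmodule.on ring_quot.
HB.instance Definition _ : EqQuotient A (Quotient.equiv ideal_gen) ring_quot :=
  EqQuotient.on ring_quot.
HB.instance Definition _ := isZmodQuotient.Build A (Quotient.equiv ideal_gen)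
  0 -%R +%R ring_quot pi_zeror (@pi_oppr _ _ _ _ _ _) (@pi_addr _ _ _ _ _ _).

Definition ring_quot_one : ring_quot := lift_cst ring_quot 1.
Definition ring_quot_mul := lift_op2 ring_quot *%R.

Canonical pi_ring_quot_one := PiConst ring_quot_one.

Lemma pi_ring_quot_mul : {morph \pi_ring_quot : x y / x * y >-> ring_quot_mul x y}.
Proof.
move=> x y; unlock ring_quot_mul; apply/eqP; rewrite -Quotient.idealrBE.
set x' := generic_quotient.repr _; set y' := generic_quotient.repr _.
have Jx : x - x' \in ideal_gen by rewrite Quotient.idealrBE reprK.
have Jy : y - y' \in ideal_gen by rewrite Quotient.idealrBE reprK.
have -> : x * y - x' * y' = 1 * (x - x') * y + x' * (y - y') * 1.
  by rewrite mul1r mulr1 mulrBl mulrBr addrA subrK.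
by rewrite rpredD // ideal_genM.
Qed.
Canonical pi_ring_quot_mul_morph := PiMorph2 pi_ring_quot_mul.

Fact ring_quot_mulA : associative ring_quot_mul.
Proof. by move=> x y z; rewrite -[x]reprK -[y]reprK -[z]reprK !piE mulrA. Qed.
Fact ring_quot_mul1l : left_id ring_quot_one ring_quot_mul.
Proof. by move=> x; rewrite -[x]reprK !piE mul1r. Qed.
Fact ring_quot_mul1r : right_id ring_quot_one ring_quot_mul.
Proof. by move=> x; rewrite -[x]reprK !piE mulr1. Qed.
Fact ring_quot_mulDl : left_distributive ring_quot_mul +%R.
Proof.
move=> x y z; rewrite -[x]reprK -[y]reprK -[z]reprK.
by rewrite -!raddfD -!pi_ring_quot_mul -raddfD mulrDl.
Qed.
Fact ring_quot_mulDr : right_distributive ring_quot_mul +%R.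
Proof.
move=> x y z; rewrite -[x]reprK -[y]reprK -[z]reprK.
by rewrite -!raddfD -!pi_ring_quot_mul -raddfD mulrDr.
Qed.

HB.instance Definition _ := GRing.Zmodule_isPzRing.Build ring_quot
  ring_quot_mulA ring_quot_mul1l ring_quot_mul1r ring_quot_mulDl
  ring_quot_mulDr.

End TwoSidedQuotient.

(* V = k^I with basis I; an element of V (x) V, or of V* (x) V* in the dual   *)
(* basis, is given by its coefficients on I * I, so that the duality pairing  *)
(* is \sum_p f p * r p.                                                       *)
Section QuadraticAlgebra.
Variables (k : fieldType) (I : finType).

Definition free_alg := {malg k[{fmonom I}]}.

Definition free_gen (i : I) : free_alg := mkmalgU (fmu i) 1.

Definition quad_elt (r : {ffun I * I -> k}) : free_alg :=
  \sum_(p : I * I) r p *: (free_gen p.1 * free_gen p.2).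

Definition quad_alg (rels : set {ffun I * I -> k}) : pzRingType :=
  ring_quot (quad_elt @` rels)%classic.

Definition quad_gen (rels : set {ffun I * I -> k}) (i : I) : quad_alg rels :=
  \pi_(ring_quot (quad_elt @` rels)%classic) (free_gen i).

Definition quad_orth (rels : set {ffun I * I -> k}) : set {ffun I * I -> k} :=
  fun f => forall r, rels r -> \sum_p f p * r p = 0.

Definition quad_dual (rels : set {ffun I * I -> k}) : pzRingType :=
  quad_alg (quad_orth rels).

Definition quad_dual_gen (rels : set {ffun I * I -> k}) (i : I) :
  quad_dual rels := quad_gen (quad_orth rels) i.

(* The algebra k[M] of the monoid M generated by I with the relations         *)
(* p.1 p.2 = q.1 q.2 for E p q is quad_alg (monoid_rels E).                   *)
Definition monoid_rels (E : rel (I * I)) : set {ffun I * I -> k} :=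
  fun r => exists p q, E p q /\ r = [ffun x => (x == p)%:R - (x == q)%:R].

End QuadraticAlgebra.

Arguments monoid_rels k {I} E.

Section Fans.
Variables (R : realType) (n : nat).
Implicit Types (C D : set 'rV[R]_n) (F : set (set 'rV[R]_n)).

Definition dotv (u v : 'rV[R]_n) : R := (u *m v^T) 0 0.

Definition simplicial_cone C : Prop :=
  exists m (V : 'M[R]_(m, n)), row_free V /\
    C = (fun v => exists2 a : 'rV[R]_m, forall i, 0 <= a 0 i & v = a *m V).

Definition cone_face D C : Prop :=
  exists h, (forall v, C v -> 0 <= dotv h v) /\
    D = (fun v => C v /\ dotv h v = 0).

Definition simplicial_fan F : Prop :=
  [/\ finite_set F,
      forall C, F C -> simplicial_cone C,
      forall C D, F C -> cone_face D C -> F D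
    & forall C D, F C -> F D ->
        cone_face (setI C D) C /\ cone_face (setI C D) D].

Definition fan_support F : set 'rV[R]_n := fun v => exists2 C, F C & C v.

Definition maximal_cones F : set (set 'rV[R]_n) :=
  fun C => F C /\ forall D, F D -> subset C D -> D = C.

End Fans.

Section ReflectionGroup.
Variables (R : realType) (n : nat) (gT : finGroupType).
Variable rG : mx_representation R [set: gT]%g n.

Definition refl_mx (a : 'rV[R]_n) : 'M[R]_n :=
  1%:M - (2 / dotv a a) *: (a^T *m a).

Definition is_root (w : gT) (a : 'rV[R]_n) : Prop :=
  a != 0 /\ rG w = refl_mx a.

Definition reflections : {set gT} := [set w | `[< exists a, is_root w a >]]%SET.

Definition refl : Type := {t : gT | t \in reflections}.
HB.instance Definition _ := SubFinite.on refl.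

Definition refl_prod (s : seq refl) : gT := (\prod_(t <- s) val t)%g.

Definition is_refl_prod (w : gT) (m : nat) : bool :=
  [exists s : m.-tuple refl, refl_prod s == w].

Definition refl_length (w : gT) : nat :=
  if pselect (exists m, is_refl_prod w m) is left ex then ex_minn ex else 0%N.

Definition leT (w z : gT) : bool :=
  (refl_length w + refl_length (w^-1 * z)%g == refl_length z)%N.

Definition NC (c : gT) (j : nat) (w : gT) : bool :=
  leT w c && (refl_length w == j).

Section PositiveRoots.
Variable rho : refl -> 'rV[R]_n.

(* The positive half-space is {v | 0 < dotv h v}. Roots are not assumed to    *)
(* have any particular length.                                                *)
Definition positive_roots (h : 'rV[R]_n) : Prop :=
  forall t, is_root (val t) (rho t) /\ 0 < dotv h (rho t).

Definition cone (A : {set refl}) : set 'rV[R]_n :=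
  fun v => exists2 a : refl -> R,
    forall t, 0 <= a t & v = \sum_(t in A) a t *: rho t.

(* S is the set of simple reflections of the reflection subgroup whose set of *)
(* reflections is A, with respect to the positive roots rho.                  *)
Definition simple_system (A S : {set refl}) : Prop :=
  [/\ S \subset A, free [seq rho t | t in S]
    & forall t, t \in A -> cone S (rho t)].

Definition rank2_parabolic (S : {set refl}) (P : {set gT}) : Prop :=
  exists (I : {set refl}) (g : gT),
    [/\ I \subset S, #|I| = 2%N & P = (<<[set val t | t in I]>> :^ g)%g].

Definition strict_total_order (prec : rel refl) : Prop :=
  [/\ irreflexive prec, transitive prec
    & forall t u, t != u -> prec t u || prec u t].

(* next and prev are cyclic, as are the indices of u_1, ..., u_m.             *)
Definition reflection_ordering (S : {set refl}) (prec : rel refl) : Prop :=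
  strict_total_order prec /\
  forall P, rank2_parabolic S P ->
    let TP := [set t : refl | val t \in P]%SET in
    exists (u1 um : refl) (us : seq refl), let u := u1 :: rcons us um in
    [/\ uniq u, u =i TP, simple_system TP [set u1; um]%SET,
        {in u, forall t,
          (val (next u t) * val t = val t * val (prev u t))%g}
      & sorted prec u || sorted prec (rev u)].

Definition c_compatible (c : gT) (prec : rel refl) : Prop :=
  forall w, NC c 2 w ->
  forall u, sorted prec u -> u =i [set t : refl | leT (val t) w]%SET ->
  {in u, forall t, w = (val t * val (prev u t))%g}.

Definition is_facet (c : gT) (f : {set refl}) : Prop :=
  exists s : n.-tuple refl,
    [/\ f = [set t in s]%SET, c = refl_prod s
      & forall i j, i != j -> 0 <= dotv (rho (tnth s i)) (rho (tnth s j))].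

Definition is_face (c : gT) (f : {set refl}) : Prop :=
  exists2 g, is_facet c g & f \subset g.

Definition nc (c : gT) (f : {set refl}) : gT :=
  odflt 1%g [pick w | NC c #|f| w &&
    [exists s : #|f|.-tuple refl,
      ([set t in s]%SET == f) && (refl_prod s == w)]].

Definition decr_seq (prec : rel refl) (f : {set refl}) : seq refl :=
  sort (fun t u => (t == u) || prec u t) (enum f).

Definition root_mx (j : nat) (s : seq refl) : 'M[R]_(j, n) :=
  \matrix_(i < j) (map rho s)`_i.

(* The family us is a basis of the span of ts with the orientation of ts.     *)
Definition pos_oriented (j : nat) (ts us : seq refl) : Prop :=
  exists2 Q : 'M[R]_j, root_mx j us = Q *m root_mx j ts & 0 < \det Q.

Definition omega (prec : rel refl) (j : nat) (ts : j.-tuple refl)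
    (f : {set refl}) : int :=
  if `[< pos_oriented j ts (decr_seq prec f) >] then 1 else -1.

Definition Xfaces (c : gT) (j : nat) (ts : j.-tuple refl) :
    {set {set refl}} :=
  [set f | `[< [/\ is_face c f, nc c f = refl_prod ts
                 & subset (cone f) (cone [set t in ts]%SET)] >]]%SET.

End PositiveRoots.

(* t u = u (u t u) whenever tu <=_T c.                                        *)
Definition dual_braid_rel (c : gT) (p q : refl * refl) : bool :=
  [&& leT (val p.1 * val p.2)%g c, q.1 == p.2
    & val q.2 == (val p.2 * val p.1 * val p.2)%g].

Definition dual_braid_alg (k : fieldType) (c : gT) : pzRingType :=
  quad_alg (monoid_rels k (dual_braid_rel c)).

Definition dual_alg (k : fieldType) (c : gT) : pzRingType :=
  quad_dual (monoid_rels k (dual_braid_rel c)).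

Definition x_gen (k : fieldType) (c : gT) (t : refl) : dual_alg k c :=
  quad_dual_gen (monoid_rels k (dual_braid_rel c)) t.

Definition x_face (k : fieldType) (c : gT) (prec : rel refl)
    (f : {set refl}) : dual_alg k c :=
  \prod_(u <- decr_seq prec f) x_gen k c u.

End ReflectionGroup.

(* Main.v *)
(** Let [E(x, y) = <(1 - c)^-1 y, x>]. Then [E(x, y) + E(y, x) = <x, y>], and the
    roots of any factorization [c = t_1 ... t_n] satisfy [E(t_i, t_l) = 0] for
    [i < l]. Moreover [E(t, u) >= 0 >= E(u, t)] whenever [t] precedes [u] in a
    c-compatible reflection ordering: the minimal reflection [b] is simple and
    initial in [c], where the signs can be read off in the basis of simple roots,
    and conjugating the simple system by [b] moves [b] to the end without
    changing [c], so that every reflection becomes minimal in turn.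

    The signs imply that a vector has at most one expression with nonnegative
    coefficients supported on a decreasing factorization: apply [E(t, .)] for the
    largest [t] at which two expressions differ. This gives the fan property.

    In rank 2, an ascent [t u] of a factorization has [t] and [u] as the two
    simple reflections [u_1, u_m] of its plane, and both the cone of [t, u] and
    the product [x_t x_u] split along the pairs [u_(i+1), u_i]. Rewriting ascents
    terminates, as it increases factorizations lexicographically, and it ends
    with decreasing factorizations, which are exactly the faces of the positive
    cluster complex. *)

Require Import Defs.
From mathcomp Require Import all_boot all_order all_fingroup all_algebra.
From mathcomp Require Import all_character.
From mathcomp Require Import boolp classical_sets cardinality reals.
From mathcomp Require Import monalg ring lra zify.

Set Implicit Arguments.
Unset Strict Implicit.
Unset Printing Implicit Defensive.

Import Order.TTheory GRing.Theory Num.Theory.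

Local Open Scope ring_scope.

(** * Sequences and determinants *)

(** The two hypotheses on [prec] speak of different objects: [reflection_ordering] of rank 2
    parabolic subgroups, [c_compatible] of the reflections below an element of length 2. Both are
    brought to the plane spanned by two roots. Such a plane always carries a rank 2 parabolic
    subgroup, because a generic vector orthogonal to it can be moved into the dominant chamber; and
    when [t u] is a reduced prefix of c, the reflections below [t u] are exactly those of the plane
    of [t] and [u]. Order in a plane then becomes the sign of an area.

    Roots have arbitrary lengths, so a group element sends a root to a root only up to a nonzero
    factor, and much of the work consists in controlling the sign of that factor.

    In the expansion, the relation that replaces an ascent carries a minus sign. It is exactly
    compensated by orientation: passing from the pair [t, u] to a descending pair of the same plane
    reverses it. *)

Section CyclicNth.
Variables (T : eqType) (x0 : T) (l : seq T).
Hypothesis ul : uniq l.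

Lemma next_nthS i : (i.+1 < size l)%N -> next l (nth x0 l i) = nth x0 l i.+1.
Proof.
move=> si; rewrite next_nth mem_nth ?(ltnW si) //.
case: l ul si => // y p up si; rewrite index_uniq ?(ltnW si) //=.
by apply: set_nth_default.
Qed.

Lemma prev_nthS i : (i.+1 < size l)%N -> prev l (nth x0 l i.+1) = nth x0 l i.
Proof.
move=> si; rewrite prev_nth mem_nth //.
case: l ul si => // y p /= /andP[_ up] si; rewrite index_uniq //.
by apply: set_nth_default; rewrite /= ltnW.
Qed.

Lemma prev_nth0 : (0 < size l)%N -> prev l (nth x0 l 0) = nth x0 l (size l).-1.
Proof.
move=> s0; rewrite prev_nth mem_nth //.
case: l ul s0 => // y p /= /andP[yp _] _.
by rewrite memNindex //; apply: set_nth_default => /=.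
Qed.

End CyclicNth.

Lemma pair_subseq (T : eqType) (τ : seq T) (t u : T) : t \in τ -> u \in τ -> t != u ->
  subseq [:: t; u] τ || subseq [:: u; t] τ.
Proof.
case/splitPr=> τ1 τ2; rewrite mem_cat inE eq_sym => uτ tu; move: uτ.
rewrite (negPf tu) /= => /orP[u1|u2]; apply/orP; [right|left].
  rewrite -[[:: u; t]]/([:: u] ++ [:: t]).
  by apply: cat_subseq; rewrite sub1seq ?mem_head.
rewrite -[[:: t; u]]cat0s; apply: cat_subseq (sub0seq _) _.
by rewrite /= eqxx sub1seq.
Qed.

Lemma pairwise_subseq2 (T : eqType) (r : rel T) (τ : seq T) :
  (forall t u : T, subseq [:: t; u] τ -> r t u) -> pairwise r τ.
Proof.
elim: τ => //= x τ IH H; apply/andP; split.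
  by apply/allP => u uτ; apply: H; rewrite eqxx sub1seq.
by apply: IH => t u tu; apply: H; case: ifP => // _; apply: subseq_trans tu; apply: subseq_cons.
Qed.

Lemma subseq2_pairwise (T : eqType) (r : rel T) (τ : seq T) (t u : T) :
  pairwise r τ -> subseq [:: t; u] τ -> r t u.
Proof. by move=> pw /subseq_pairwise/(_ pw) /= /andP[/andP[]]. Qed.

Section TwoRows.
Variables (F : comNzRingType) (m : nat) (A : 'M[F]_m) (p q : 'I_m).
Hypothesis pq : p != q.

Definition rows2 (x y : 'rV[F]_m) : 'M[F]_m :=
  \matrix_i (if i == p then x else if i == q then y else row i A).

Lemma det_rows2_l a b x x' y :
  \det (rows2 (a *: x + b *: x') y) = a * \det (rows2 x y) + b * \det (rows2 x' y).
Proof.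
apply: (@determinant_multilinear _ _ _ _ _ p).
- by rewrite !rowK eqxx.
- by apply/matrixP => i j; rewrite !mxE eq_sym (negPf (neq_lift _ _)).
- by apply/matrixP => i j; rewrite !mxE eq_sym (negPf (neq_lift _ _)).
Qed.

Lemma det_rows2_r a b x y y' :
  \det (rows2 x (a *: y + b *: y')) = a * \det (rows2 x y) + b * \det (rows2 x y').
Proof.
apply: (@determinant_multilinear _ _ _ _ _ q).
- by rewrite !rowK eq_sym (negPf pq) eqxx.
- by apply/matrixP => i j; rewrite !mxE [lift q i == q]eq_sym (negPf (neq_lift _ _)).
- by apply/matrixP => i j; rewrite !mxE [lift q i == q]eq_sym (negPf (neq_lift _ _)).
Qed.

Lemma det_rows2_alt x : \det (rows2 x x) = 0.
Proof.
apply: (determinant_alternate pq) => i; rewrite !mxE eqxx.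
by rewrite [q == p]eq_sym (negPf pq) eqxx.
Qed.

(** The factor is the oriented area of the two coordinate pairs, the quantity whose sign [pl_area]
    controls. *)
Lemma det_rows2 a b a' b' x y :
  \det (rows2 (a *: x + b *: y) (a' *: x + b' *: y)) = (a * b' - b * a') * \det (rows2 x y).
Proof.
have anti : \det (rows2 y x) = - \det (rows2 x y).
  have := det_rows2_alt (1 *: x + 1 *: y); rewrite det_rows2_l !det_rows2_r.
  rewrite !det_rows2_alt !mul1r addr0 add0r addrC => /eqP.
  by rewrite addr_eq0 => /eqP.
rewrite det_rows2_l !det_rows2_r !det_rows2_alt anti; ring.
Qed.

End TwoRows.

(** * Reflections and roots *)

Section Dotv.
Variables (R : realType) (n : nat).
Implicit Types u v w a b : 'rV[R]_n.

Lemma dotvC u v : dotv u v = dotv v u.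
Proof. by rewrite /dotv -{1}[u]trmxK -trmx_mul mxE. Qed.

Lemma dotvDl u v w : dotv (u + v) w = dotv u w + dotv v w.
Proof. by rewrite /dotv mulmxDl mxE. Qed.

Lemma dotvDr u v w : dotv w (u + v) = dotv w u + dotv w v.
Proof. by rewrite dotvC dotvDl !(dotvC w). Qed.

Lemma dotvZl x u v : dotv (x *: u) v = x * dotv u v.
Proof. by rewrite /dotv -scalemxAl mxE. Qed.

Lemma dotvZr x u v : dotv u (x *: v) = x * dotv u v.
Proof. by rewrite dotvC dotvZl dotvC. Qed.

Lemma dotvNl u v : dotv (- u) v = - dotv u v.
Proof. by rewrite -scaleN1r dotvZl mulN1r. Qed.

Lemma dotvNr u v : dotv u (- v) = - dotv u v.
Proof. by rewrite dotvC dotvNl dotvC. Qed.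

Lemma dotv0l v : dotv 0 v = 0.
Proof. by rewrite -(scale0r (0 : 'rV_n)) dotvZl mul0r. Qed.

Lemma dotv0r v : dotv v 0 = 0.
Proof. by rewrite dotvC dotv0l. Qed.

Definition dotvE := (dotvDl, dotvDr, dotvNl, dotvNr, dotvZl, dotvZr).

Lemma dotv_sumr (I : Type) (r : seq I) (P : pred I) (F : I -> 'rV[R]_n) u :
  dotv u (\sum_(i <- r | P i) F i) = \sum_(i <- r | P i) dotv u (F i).
Proof. exact: (big_morph (dotv u) (fun x y => dotvDr x y u) (dotv0r u)). Qed.

Lemma dotv_suml (I : Type) (r : seq I) (P : pred I) (F : I -> 'rV[R]_n) u :
  dotv (\sum_(i <- r | P i) F i) u = \sum_(i <- r | P i) dotv (F i) u.
Proof. by rewrite dotvC dotv_sumr; apply: eq_bigr => i _; rewrite dotvC. Qed.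

Lemma dotvv_sum v : dotv v v = \sum_i v 0 i ^+ 2.
Proof. by rewrite /dotv mxE; apply: eq_bigr => i _; rewrite mxE expr2. Qed.

Lemma dotvv_ge0 v : 0 <= dotv v v.
Proof. by rewrite dotvv_sum sumr_ge0 // => i _; rewrite sqr_ge0. Qed.

Lemma dotvv_eq0 v : dotv v v = 0 -> v = 0.
Proof.
rewrite dotvv_sum => /eqP; rewrite psumr_eq0 => [/allP v0|i _]; last first.
  by rewrite sqr_ge0.
apply/rowP => i; rewrite mxE; apply/eqP.
by rewrite -sqrf_eq0; apply: (implyP (v0 i _)) => //; rewrite mem_index_enum.
Qed.

Lemma dotvv_gt0 v : v != 0 -> 0 < dotv v v.
Proof.
by move=> v0; rewrite lt_def dotvv_ge0 andbT; apply: contra v0 => /eqP/dotvv_eq0->.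
Qed.

Lemma mulmx_refl a v :
  v *m refl_mx a = v - (2 * dotv v a / dotv a a) *: a.
Proof.
rewrite /refl_mx mulmxBr mulmx1 -scalemxAr mulmxA.
rewrite [v *m a^T]mx11_scalar mul_scalar_mx scalerA -/(dotv v a).
by congr (_ - _ *: _); rewrite mulrAC.
Qed.

Lemma dotv_refl a v w : a != 0 ->
  dotv (v *m refl_mx a) (w *m refl_mx a) = dotv v w.
Proof.
move=> /dotvv_gt0 a0; rewrite !mulmx_refl !dotvE !(dotvC a).
by field; rewrite gt_eqF.
Qed.

Lemma refl_mx_prop a b : a != 0 -> b != 0 -> refl_mx a = refl_mx b ->
  exists2 x, x != 0 & a = x *: b.
Proof.
move=> a0 b0 /(congr1 (mulmx a)); rewrite !mulmx_refl mulfK; last first.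
  by rewrite gt_eqF // dotvv_gt0.
move=> /addrI /oppr_inj.
rewrite -mulrA -scalerA => /(@scalerI _ _ 2) aE.
have {}aE : a = (dotv a b / dotv b b) *: b by apply: aE; rewrite pnatr_eq0.
exists (dotv a b / dotv b b) => //.
by apply: contra a0 => /eqP x0; rewrite aE x0 scale0r.
Qed.

Lemma refl_mxZ x a : x != 0 -> refl_mx (x *: a) = refl_mx a.
Proof.
move=> x0; apply/matrixP => i k; rewrite /refl_mx !dotvE !mxE !big_ord1 !mxE.
have [->|a0] := eqVneq (dotv a a) 0; first by rewrite !(mulr0, invr0) !mul0r.
by field; rewrite x0 a0.
Qed.

Lemma orthogonal_part a b w : exists v x y,
  [/\ dotv v a = 0, dotv v b = 0 & w = v + x *: a + y *: b].
Proof.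
(* Gram-Schmidt. For a zero vector the quotient is 0, and orthogonality to it is automatic. *)
pose p (c d : 'rV[R]_n) := dotv d c / dotv c c.
have pE c d : dotv (d - p c d *: c) c = 0.
  have [->|c0] := eqVneq c 0; first by rewrite dotv0r.
  by rewrite !dotvE /p; field; rewrite gt_eqF // dotvv_gt0.
pose b' := b - p a b *: a; pose w' := w - p a w *: a.
exists (w' - p b' w' *: b'), (p a w - p b' w' * p a b), (p b' w').
have H0 : dotv (w' - p b' w' *: b') a = 0.
  by rewrite dotvDl dotvNl dotvZl !pE mulr0 subrr.
split=> //.
  have -> : b = b' + p a b *: a by rewrite subrK.
  by rewrite dotvDr dotvZr H0 mulr0 addr0 pE.
by apply/rowP => i; rewrite {3}/b' {1}/w' !mxE; ring.
Qed.

End Dotv.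

Section DualBraid.
Variables (R : realType) (n : nat) (gT : finGroupType).
Variable rG : mx_representation R [set: gT]%g n.
Hypothesis faithfulW : mx_faithful rG.
Hypothesis generatedW : generated (reflections rG) = [set: gT]%SET.
Local Notation refl := (refl rG).
Implicit Types (t u : refl) (g : gT) (v w : 'rV[R]_n).

Definition root_choice (r : refl -> 'rV[R]_n) := forall t, is_root rG (val t) (r t).

Lemma act_mul v g1 g2 : v *m rG (g1 * g2)%g = v *m rG g1 *m rG g2.
Proof. by rewrite repr_mxM ?inE // mulmxA. Qed.

Lemma act_inv v g : v *m rG g *m rG g^-1%g = v.
Proof. by rewrite -act_mul mulgV repr_mx1 mulmx1. Qed.

Lemma rG_inj g1 g2 : rG g1 = rG g2 -> g1 = g2.
Proof. by move=> /(mx_faithful_inj faithfulW); apply; rewrite inE. Qed.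

Lemma act_refl r t v : root_choice r ->
  v *m rG (val t) = v - (2 * dotv v (r t) / dotv (r t) (r t)) *: r t.
Proof. by move=> rP; rewrite -mulmx_refl; case: (rP t) => _ <-. Qed.

Lemma root_neq0 r t : root_choice r -> r t != 0.
Proof. by move=> rP; case: (rP t). Qed.

Lemma root_gt0 r t : root_choice r -> 0 < dotv (r t) (r t).
Proof. by move=> rP; rewrite dotvv_gt0 ?root_neq0. Qed.

Lemma act_refl_self r t : root_choice r -> r t *m rG (val t) = - r t.
Proof.
move=> rP; rewrite (act_refl _ _ rP) mulfK ?gt_eqF ?root_gt0 //.
by rewrite scaler_nat mulr2n opprD addrA subrr sub0r.
Qed.

Lemma refl_root t : exists a, is_root rG (val t) a.
Proof. by case: t => t /= tT; move: (tT); rewrite inE => /asboolP. Qed.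

Lemma act_eq g1 g2 : (forall v, v *m rG g1 = v *m rG g2) -> g1 = g2.
Proof.
by move=> E; apply: rG_inj; rewrite -[LHS]mul1mx -[RHS]mul1mx;
   apply/row_matrixP => i; rewrite !row_mul E.
Qed.

Lemma val_sqr t : (val t * val t = 1)%g.
Proof.
have [a [a0 aE]] := refl_root t; apply: act_eq => v.
rewrite act_mul repr_mx1 mulmx1 aE mulmx_refl mulmx_refl !dotvE.
have /gt_eqF/negbT aa := dotvv_gt0 a0.
rewrite -[RHS]addr0 -addrA; congr (_ + _).
rewrite -opprD -scalerDl; apply/eqP; rewrite oppr_eq0 scaler_eq0; apply/orP; left.
by apply/eqP; field.
Qed.

Lemma val_inv t : ((val t)^-1 = val t)%g.
Proof. by rewrite -[LHS]mulg1 -(val_sqr t) mulKg. Qed.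

Lemma refl_generated (Q : gT -> Prop) :
  Q 1%g -> (forall t g, Q g -> Q (val t * g)%g) -> forall g, Q g.
Proof.
move=> Q1 QM g.
have: g \in generated (reflections rG) by rewrite generatedW inE.
move=> /gen_prodgP [m [c cT ->]] {g}.
elim: m c cT => [|m IHm] c cT; first by rewrite big_ord0.
rewrite big_ord_recl; apply: (QM (exist _ (c ord0) (cT ord0))).
by apply: IHm => i; apply: cT.
Qed.

Lemma dotv_act g v w : dotv (v *m rG g) (w *m rG g) = dotv v w.
Proof.
elim/refl_generated: g v w => [|t g IHg] v w; first by rewrite repr_mx1 !mulmx1.
by rewrite !act_mul IHg; have [a [a0 ->]] := refl_root t; rewrite dotv_refl.
Qed.

Lemma dotv_actl g v w : dotv (v *m rG g) w = dotv v (w *m rG g^-1%g).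
Proof. by rewrite -(dotv_act g^-1 (v *m _)) act_inv. Qed.

Lemma is_root_conj t a g : is_root rG (val t) a -> is_root rG (val t ^ g)%g (a *m rG g).
Proof.
move=> [a0 aE]; split.
  apply: contra a0 => /eqP a0.
  by rewrite -(act_inv a g) a0 mul0mx.
rewrite -[LHS]mul1mx -[RHS]mul1mx; apply/row_matrixP => i; rewrite !row_mul.
set v := row i _; rewrite mulmx_refl dotv_act conjgE !act_mul aE mulmx_refl.
rewrite mulmxBl -act_mul mulVg repr_mx1 mulmx1 -scalemxAl.
by rewrite dotv_actl invgK.
Qed.

Lemma conjr_subproof t g : (val t ^ g)%g \in reflections rG.
Proof.
have [a aP] := refl_root t.
by rewrite inE; apply/asboolP; exists (a *m rG g); apply: is_root_conj.
Qed.

Definition conjr t g : refl := 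
  exist (fun g => g \in reflections rG) _ (conjr_subproof t g).

Lemma val_conjr t g : val (conjr t g) = (val t ^ g)%g. Proof. by []. Qed.

Lemma root_inj r t u x : root_choice r -> r t = x *: r u -> t = u.
Proof.
move=> rP tu; apply: val_inj; apply: rG_inj.
have [t0 ->] := rP t; have [u0 ->] := rP u; rewrite tu refl_mxZ //.
by apply: contra t0 => /eqP x0; rewrite tu x0 scale0r.
Qed.

Lemma root_conj r t g : root_choice r ->
  exists2 x, x != 0 & r t *m rG g = x *: r (conjr t g).
Proof.
move=> rP; have [a0 aE] := is_root_conj g (rP t).
have [b0 bE] := rP (conjr t g).
by apply: refl_mx_prop => //; rewrite -aE -bE.
Qed.

Lemma conjrK t u : conjr (conjr t (val u)) (val u) = t.
Proof. by apply: val_inj; rewrite !val_conjr -conjgM val_sqr conjg1. Qed.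

Lemma conjr_neq t u : t != u -> conjr t (val u) != u.
Proof.
apply: contra => /eqP /(congr1 (fun z => conjr z (val u))); rewrite conjrK => ->.
by apply/eqP; apply: val_inj; rewrite val_conjr conjgE mulKg.
Qed.

Lemma orthogonal_commute r t u : root_choice r -> dotv (r t) (r u) = 0 ->
  (val t * val u = val u * val t)%g.
Proof.
move=> rP tu; apply: act_eq => v.
rewrite !act_mul !(act_refl _ _ rP) !dotvE (dotvC (r u)) tu.
by rewrite !(mulr0, subr0) addrAC.
Qed.

Lemma val_neq1 t : val t != 1%g.
Proof.
have [a [a0 aE]] := refl_root t; apply/eqP => t1.
have := mulmx_refl a a; rewrite -aE t1 repr_mx1 mulmx1 mulfK ?gt_eqF ?dotvv_gt0 //.
move=> /eqP; rewrite -subr_eq0 opprB addrCA subrr addr0 scaler_eq0 pnatr_eq0 /=.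
exact/negP.
Qed.

Lemma root_fixed r t v : root_choice r -> v *m rG (val t) = v -> dotv v (r t) = 0.
Proof.
move=> rP; rewrite (act_refl _ _ rP) => /eqP; rewrite -subr_eq0 addrAC subrr sub0r.
rewrite oppr_eq0 scaler_eq0 (negPf (root_neq0 t rP)) orbF !mulf_eq0 invr_eq0.
by rewrite pnatr_eq0 (gt_eqF (root_gt0 t rP)) orbF => /eqP.
Qed.

(* The next notions apply to any choice of a root for each reflection, and not *)
(* only to positive roots: the proof changes the positive system.              *)
Definition indep (r : refl -> 'rV[R]_n) (A : {set refl}) :=
  forall a : refl -> R, \sum_(t in A) a t *: r t = 0 -> {in A, forall t, a t = 0}.

Lemma indepP r (A : {set refl}) : reflect (indep r A) (free [seq r t | t in A]).
Proof.
pose X := in_tuple [seq r t | t in A].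
have sX : size [seq r t | t in A] = #|A| by rewrite size_map cardE.
have sE : size (enum A) = size [seq r t | t in A] by rewrite size_map.
apply: (iffP (@freeP _ _ _ X)) => [fr a a0 t tA|ind k k0 i].
  have si : (index t (enum A) < size [seq r t | t in A])%N.
    by rewrite sX cardE index_mem mem_enum.
  have := fr (fun i => a (nth t (enum A) i)) _ (Ordinal si).
  rewrite /= nth_index ?mem_enum //; apply.
  rewrite -{}[RHS]a0 -[RHS]big_enum [RHS](big_nth t) [RHS]big_mkord /= sE.
  by apply: eq_bigr => j _; rewrite (nth_map t) // sE.
have /card_gt0P[t0 _] : (0 < #|A|)%N by rewrite -sX; apply: leq_ltn_trans (ltn_ord i).
have ui : {in enum A, forall t, (index t (enum A) < size [seq r t | t in A])%N}.
  by move=> t tA; rewrite sX cardE index_mem.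
pose a t := if insub (index t (enum A)) is Some i then k i else 0.
have aE (j : 'I_(size [seq r t | t in A])) : a (nth t0 (enum A) j) = k j.
  by rewrite /a index_uniq ?enum_uniq -?cardE -?sX // valK.
have iA : (i < #|A|)%N by rewrite -sX.
rewrite -aE; apply: ind; last by rewrite -mem_enum mem_nth // -cardE.
rewrite -{}[RHS]k0 -[LHS]big_enum [LHS](big_nth t0) [LHS]big_mkord /= sE.
by apply: eq_bigr => j _; rewrite aE (nth_map t0) // sE.
Qed.

Lemma indep_eq r (A : {set refl}) a b : indep r A ->
  \sum_(t in A) a t *: r t = \sum_(t in A) b t *: r t -> {in A, a =1 b}.
Proof.
move=> ind ab t tA; apply/eqP; rewrite -subr_eq0; apply/eqP.
apply: (ind (fun t => a t - b t)) => //.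
under eq_bigr do rewrite scalerBl.
by rewrite sumrB ab subrr.
Qed.

Lemma indepS r (A B : {set refl}) : A \subset B -> indep r B -> indep r A.
Proof.
move=> AB ind a a0 t tA.
have := ind (fun t => if t \in A then a t else 0).
rewrite (big_setID A) /= (finset.setIidPr AB) [X in _ + X]big1 ?addr0; last first.
  by move=> u; rewrite inE => /andP[/negPf-> _]; rewrite scale0r.
under eq_bigr => u uA do rewrite uA.
by move=> /(_ a0 t (fintype.subsetP AB t tA)); rewrite tA.
Qed.

Lemma cone_root r (A : {set refl}) t : t \in A -> cone r A (r t).
Proof.
move=> tA; exists (fun u => (u == t)%:R); first by move=> u; rewrite ler0n.
rewrite (bigD1 t) //= eqxx scale1r big1 ?addr0 // => u /andP[_ /negPf->].
by rewrite scale0r.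
Qed.

Lemma cone0 r (A : {set refl}) : cone r A 0.
Proof.
exists (fun=> 0) => //; by rewrite big1 // => t _; rewrite scale0r.
Qed.

Lemma coneD r (A : {set refl}) v w : cone r A v -> cone r A w -> cone r A (v + w).
Proof.
move=> [a a0 ->] [b b0 ->]; exists (fun t => a t + b t).
  by move=> t; rewrite addr_ge0.
by rewrite -big_split; apply: eq_bigr => t _; rewrite scalerDl.
Qed.

Lemma coneZ r (A : {set refl}) x v : 0 <= x -> cone r A v -> cone r A (x *: v).
Proof.
move=> x0 [a a0 ->]; exists (fun t => x * a t).
  by move=> t; rewrite mulr_ge0.
by rewrite scaler_sumr; apply: eq_bigr => t _; rewrite scalerA.
Qed.

Lemma cone_sum r (A : {set refl}) (I : Type) (s : seq I) (P : pred I) F :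
  (forall i, P i -> cone r A (F i)) -> cone r A (\sum_(i <- s | P i) F i).
Proof. by move=> H; apply: big_ind => //; [exact: cone0|exact: coneD]. Qed.

Lemma cone_trans r (A B : {set refl}) :
  {in A, forall t, cone r B (r t)} -> subset (cone r A) (cone r B).
Proof.
by move=> AB v [a a0 ->]; apply: cone_sum => t tA; apply: coneZ => //; apply: AB.
Qed.

Lemma coneS r (A B : {set refl}) : A \subset B -> subset (cone r A) (cone r B).
Proof. by move=> /fintype.subsetP AB; apply: cone_trans => t /AB; apply: cone_root. Qed.

(** Acting by the simple reflection [b] changes only the coordinate at [b]. Were the factor
    negative, every other coordinate of [t] would be both nonnegative and nonpositive, forcing
    [t = b]. The choice [r] is arbitrary so that flipped positive systems are covered. *)
Lemma cone_act_simple r (B : {set refl}) b t :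
  root_choice r -> indep r B -> (forall u, cone r B (r u)) ->
  b \in B -> t != b ->
  exists2 x, 0 < x & r t *m rG (val b) = x *: r (conjr t (val b)).
Proof.
move=> rP ind cB bB tb; have [x x0 xE] := root_conj t (val b) rP.
exists x => //; rewrite lt_neqAle eq_sym x0 /= leNgt; apply/negP => xn.
have [a a0 aE] := cB t; have [a' a'0 a'E] := cB (conjr t (val b)).
pose d := 2 * dotv (r t) (r b) / dotv (r b) (r b).
have E : \sum_(u in B) a u *: r u = \sum_(u in B) (x * a' u + (u == b)%:R * d) *: r u.
  under [RHS]eq_bigr do rewrite scalerDl -(scalerA x) -(scalerA _%:R d).
  rewrite big_split -scaler_sumr -a'E -xE -aE /= (act_refl _ _ rP) -/d.
  rewrite (bigD1 b) //= eqxx scale1r big1 ?addr0 ?subrK // => u /andP[_ /negPf->].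
  by rewrite scale0r.
case/negP: tb; apply/eqP; apply: (@root_inj r _ _ (a b)) => //.
rewrite aE (bigD1 b) //= big1 ?addr0 // => u /andP[uB /negPf ub].
have := indep_eq ind E uB; rewrite ub mul0r addr0 => au.
have: a u <= 0 by rewrite au mulr_le0_ge0 // ltW.
by move=> au0; rewrite (_ : a u = 0) ?scale0r //; apply/eqP; rewrite eq_le au0 a0.
Qed.

(** * Planes spanned by two roots are rank 2 parabolic *)

Variables (h : 'rV[R]_n) (rho : refl -> 'rV[R]_n).
Hypothesis rhoP : positive_roots rho h.
Variable s : n.-tuple refl.
Hypothesis s_uniq : uniq s.
Local Notation S := [set t in s]%SET.
Hypothesis s_simple : simple_system rho [set: refl]%SET S.

Lemma rho_root : root_choice rho. Proof. by move=> t; case: (rhoP t). Qed.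
Hint Resolve rho_root : core.

Lemma height_gt0 t : 0 < dotv h (rho t). Proof. by case: (rhoP t). Qed.

Lemma simple_indep : indep rho S.
Proof. by apply/indepP; case: s_simple. Qed.

Lemma simple_cone t : cone rho S (rho t).
Proof. by case: s_simple => _ _; apply; rewrite inE. Qed.

Definition in_plane t u r := exists x y, rho r = x *: rho t + y *: rho u.

(** Reflections are treated one at a time: a root outside the plane has a nonzero component [w]
    orthogonal to it, and [v] is perturbed by a large multiple of [w]. *)
Lemma generic_orthogonal t u : exists v,
  [/\ dotv v (rho t) = 0, dotv v (rho u) = 0
    & forall r, dotv v (rho r) = 0 -> in_plane t u r].
Proof.
suff H (l : seq refl) : exists v, [/\ dotv v (rho t) = 0, dotv v (rho u) = 0
    & {in l, forall r, dotv v (rho r) = 0 -> in_plane t u r}].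
  have [v [vt vu vP]] := H (enum [set: refl]%SET).
  by exists v; split=> // r; apply: vP; rewrite mem_enum inE.
elim: l => [|r l [v [vt vu vP]]]; first by exists 0; rewrite !dotv0l.
have [rP|rNP] := pselect (in_plane t u r).
  by exists v; split=> // q; rewrite inE => /predU1P[->|/vP].
have [w [x [y [wt wu rE]]]] := orthogonal_part (rho t) (rho u) (rho r).
have w0 : w != 0.
  by apply/eqP => w0; apply: rNP; exists x, y; rewrite rE w0 add0r.
have wr : dotv w (rho r) != 0.
  by rewrite rE !dotvE wt wu !mulr0 !addr0 gt_eqF ?dotvv_gt0.
(* [K] exceeds every ratio at which [v + K *: w] could become orthogonal to a root not orthogonal to
   [w]. *)
pose K := 1 + \sum_(q : refl) `|dotv v (rho q) / dotv w (rho q)|.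
have KP q : `|dotv v (rho q) / dotv w (rho q)| < K.
  rewrite /K (bigD1 q) //= addrCA ltrDl ltr_pwDl //.
  by rewrite sumr_ge0.
exists (v + K *: w); split; rewrite ?dotvE ?vt ?vu ?wt ?wu ?mulr0 ?addr0 // => q.
move=> qin; rewrite !dotvE => qE.
have [wq|wq] := eqVneq (dotv w (rho q)) 0.
  move: qin qE; rewrite inE wq mulr0 addr0 => /predU1P[qr|/vP//].
  by move: wr; rewrite -qr wq eqxx.
have := KP q; rewrite (_ : _ / _ = - K); last first.
  by apply: (canLR (mulfK wq)); rewrite mulNr; apply/eqP; rewrite -addr_eq0 qE.
by rewrite normrN => /(le_lt_trans (ler_norm K)); rewrite ltxx.
Qed.

(** Maximize the height over the finite orbit: a negative pairing with [rho t] would let the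
    reflection [t] increase it. *)
Lemma dominant_translate v : exists g, {in S, forall t, 0 <= dotv (v *m rG g) (rho t)}.
Proof.
pose F (g : gT) := dotv h (v *m rG g).
case: (@Order.TotalTheory.arg_maxP _ _ _ 1%g xpredT F) => // g _ gmax.
exists g => t tS; rewrite leNgt; apply/negP => neg.
have : F (g * val t)%g <= F g := gmax (g * val t)%g isT; rewrite /F act_mul (act_refl _ _ rho_root).
rewrite dotvDr dotvNr dotvZr gerDl oppr_le0 leNgt => /negP; apply.
by rewrite nmulr_rlt0 ?height_gt0 // pmulr_llt0 ?invr_gt0 ?root_gt0 // pmulr_rlt0.
Qed.

Section Dominant.
Variable z : 'rV[R]_n.
Hypothesis zdom : {in S, forall t, 0 <= dotv z (rho t)}.
Let I := [set t in S | dotv z (rho t) == 0]%SET.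

Lemma dominant_cone r : dotv z (rho r) = 0 -> cone rho I (rho r).
Proof.
have [a a0 aE] := simple_cone r.
rewrite {1}aE dotv_sumr => /eqP; rewrite psumr_eq0 => [/allP H|t tS]; last first.
  by rewrite dotvZr mulr_ge0 ?zdom.
exists a => //; rewrite aE (big_setID I) /= [X in _ + X]big1 ?addr0.
  by apply: eq_bigl => t; rewrite !inE andbA andbb.
move=> t; rewrite !inE => /andP[tNI tS].
have /implyP/(_ _) := H t (mem_index_enum t); rewrite inE => /(_ tS).
by rewrite dotvZr mulf_eq0; case/orP=> [/eqP->|zt]; rewrite ?scale0r //;
   move: tNI; rewrite tS zt.
Qed.

(** Descent on height: [rho r] lies in the cone of [I], so it pairs positively with some [i] in [I],
    and reflecting in [i] gives a lower positive root still orthogonal to [z]. *)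
Lemma dominant_generated r : dotv z (rho r) = 0 ->
  val r \in generated [set val t | t in I]%SET.
Proof.
(* Dividing by the squared length makes the measure independent of the scaling of the root. *)
pose H q := dotv h (rho q) ^+ 2 / dotv (rho q) (rho q).
have [m] := ubnP #|[set q | H q < H r]%SET|; elim: m r => // m IHm r.
rewrite ltnS => rm zr.
have [rI|rNI] := boolP (r \in I).
  by apply: mem_gen; apply/imsetP; exists r.
have [a a0 aE] := dominant_cone zr.
have [i iI ir] : exists2 i, i \in I & 0 < dotv (rho i) (rho r).
  apply/exists_inP; rewrite -[X in is_true X]negbK; apply/negP => /exists_inPn H0.
  have := root_gt0 r rho_root; rewrite {1}aE dotv_suml ltNge => /negP; apply.
  rewrite sumr_le0 // => i iI; rewrite dotvZl mulr_ge0_le0 // leNgt.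
  exact: H0.
have /finset.setIdP[iS /eqP zi] := iI.
have ri : r != i by apply: contra rNI => /eqP->.
have [x x0 xE] := cone_act_simple rho_root simple_indep simple_cone iS ri.
set r' := conjr r (val i) in xE.
have xE' := xE; rewrite (act_refl _ _ rho_root) in xE'.
have zr' : dotv z (rho r') = 0.
  have : dotv z (x *: rho r') = 0 by rewrite -xE' !dotvE zr zi mulr0 subrr.
  by rewrite dotvZr => /eqP; rewrite mulf_eq0 gt_eqF //= => /eqP.
have Hr' : H r' < H r.
  have -> : H r' = dotv h (x *: rho r') ^+ 2 / dotv (rho r) (rho r).
    rewrite -(dotv_act (val i) (rho r)) xE /H !dotvE.
    by field; rewrite !gt_eqF ?root_gt0.
  rewrite ltr_pM2r ?invr_gt0 ?root_gt0 // ltr_pXn2r ?nnegrE //; first last.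
  - exact/ltW/height_gt0.
  - by rewrite dotvZr mulr_ge0 // ltW ?height_gt0.
  rewrite -xE' !dotvE gtrDl oppr_lt0 mulr_gt0 ?height_gt0 //.
  by rewrite divr_gt0 ?root_gt0 // mulr_gt0 // dotvC.
have r'in : val r' \in generated [set val t | t in I]%SET.
  apply: IHm zr'; apply: leq_trans rm; apply: proper_card.
  apply/fintype.properP; split.
    by apply/fintype.subsetP => q; rewrite !inE => /lt_trans; apply.
  by exists r'; rewrite !inE ?ltxx.
have iin : val i \in generated [set val t | t in I]%SET.
  by apply: mem_gen; apply/imsetP; exists i.
by rewrite -(conjrK r i) val_conjr groupJ.
Qed.

End Dominant.

Lemma free_pair (t u : refl) (g : gT) : t != u ->
  free [:: rho t *m rG g; rho u *m rG g].
Proof.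
move=> tu; rewrite free_cons seq1_free span_seq1; apply/andP; split; last first.
  apply: contra (root_neq0 u rho_root) => /eqP u0.
  by rewrite -(act_inv (rho u) g) u0 mul0mx.
apply: contra tu => /vlineP[x xE]; apply/eqP; apply: (@root_inj _ _ _ x rho_root).
by rewrite -(act_inv (rho t) g) xE -scalemxAl act_inv.
Qed.

(** The reflections fixing a generic vector orthogonal to the plane are those of the plane. Once the
    vector is made dominant by [g], they generate a standard parabolic subgroup, which is conjugated
    back. *)
Lemma plane_parabolic t u : t != u -> exists P, rank2_parabolic S P /\
  forall r, (val r \in P) <-> in_plane t u r.
Proof.
move=> tu; have [v [vt vu vP]] := generic_orthogonal t u.
have vP' r : in_plane t u r -> dotv v (rho r) = 0.
  by move=> [x [y ->]]; rewrite !dotvE vt vu !mulr0 addr0.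
have [g zdom] := dominant_translate v.
set z := v *m rG g in zdom; pose I := [set t in S | dotv z (rho t) == 0]%SET.
have zconj r : dotv z (rho (conjr r g)) = 0 <-> dotv v (rho r) = 0.
  have [x x0 xE] := root_conj r g rho_root.
  rewrite -(dotv_act g v) xE dotvZr -/z; split=> [->|/eqP]; rewrite ?mulr0 //.
  by rewrite mulf_eq0 (negPf x0) => /eqP.
have cardI : #|I| = 2%N.
  (* The span of [I] is the plane moved by [g], so independence turns the dimension 2 into the
     cardinality. *)
  have indI : indep rho I.
    by apply: indepS simple_indep; apply/fintype.subsetP => i; rewrite !inE => /andP[].
  have /indepP := indI; rewrite /free size_map -cardE => /eqP <-.
  have /eqP := free_pair g tu; rewrite /= => <-; congr (\dim _).
  apply/eqP; rewrite eqEsubv; apply/andP; split; apply/span_subvP => w.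
    move=> /mapP[i]; rewrite mem_enum => /finset.setIdP[_ /eqP zi] ->.
    have [x x0 xE] := root_conj i g^-1 rho_root.
    have [y1 [y2 yE]] : in_plane t u (conjr i g^-1).
      apply: vP; apply/eqP; rewrite -(mulrI_eq0 _ (lregP x0)) -dotvZr -xE.
      by rewrite -dotv_actl zi.
    have -> : rho i = x *: (y1 *: (rho t *m rG g) + y2 *: (rho u *m rG g)).
      by rewrite !scalemxAl -mulmxDl -yE scalemxAl -xE -{2}(invgK g) act_inv.
    by rewrite memvZ // memvD // memvZ // memv_span // !inE eqxx ?orbT.
  have VP r : dotv v (rho r) = 0 -> rho r *m rG g \in <<[seq rho t | t in I]>>%VS.
    move=> vr; have [x x0 ->] := root_conj r g rho_root; rewrite memvZ //.
    have [a _ ->] := dominant_cone zdom ((zconj r).2 vr).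
    apply: memv_suml => i iI; rewrite memvZ // memv_span //.
    by apply/mapP; exists i; rewrite ?mem_enum.
  by rewrite !inE => /orP[]/eqP->; apply: VP.
exists (generated [set val t | t in I] :^ g^-1)%g%SET; split.
  exists I, (g^-1)%g; split=> //.
  by apply/fintype.subsetP => i; rewrite !inE => /andP[].
move=> r; rewrite mem_conjg invgK; split=> [rI|rt].
  apply: vP; apply/zconj; apply: root_fixed => //.
  have: generated [set val t | t in I]%SET \subset [set g | z *m rG g == z]%SET.
    have stG : group_set [set g | z *m rG g == z]%SET.
      apply/group_setP; split=> [|g1 g2]; rewrite !inE ?repr_mx1 ?mulmx1 //.
      by rewrite act_mul => /eqP->.
    rewrite (gen_subG _ (Group stG)); apply/fintype.subsetP => _ /imsetP[i iI ->].
    have /finset.setIdP[_ /eqP zi] := iI.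
    by rewrite inE (act_refl _ _ rho_root) zi mulr0 mul0r scale0r subr0.
  by move=> /fintype.subsetP/(_ _ rI); rewrite inE => /eqP.
apply: (@dominant_generated z zdom (conjr r g)).
by apply/zconj; apply: vP'.
Qed.

(** * The Euler form and reduced factorizations *)

Variable c : gT.
Hypothesis cE : c = refl_prod s.

Lemma refl_prod_nil : refl_prod ([::] : seq refl) = 1%g.
Proof. exact: big_nil. Qed.

Lemma refl_prod_cons t (τ : seq refl) : refl_prod (t :: τ) = (val t * refl_prod τ)%g.
Proof. exact: big_cons. Qed.

Lemma refl_prod_cat (τ1 τ2 : seq refl) :
  refl_prod (τ1 ++ τ2) = (refl_prod τ1 * refl_prod τ2)%g.
Proof. exact: big_cat. Qed.

Lemma refl_prod2 t u : refl_prod [:: t; u] = (val t * val u)%g.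
Proof. by rewrite !refl_prod_cons refl_prod_nil mulg1. Qed.

Lemma refl_prod_conj (σ : seq refl) g :
  refl_prod [seq conjr t g | t <- σ] = (refl_prod σ ^ g)%g.
Proof.
elim: σ => [|t σ IH]; first by rewrite /= refl_prod_nil conj1g.
by rewrite /= !refl_prod_cons IH conjMg.
Qed.

(** Each reflection displaces a vector along its own root. *)
Lemma move_span (τ : seq refl) v :
  v - v *m rG (refl_prod τ) \in <<map rho τ>>%VS.
Proof.
elim: τ v => [|t τ IHτ] v; first by rewrite refl_prod_nil repr_mx1 mulmx1 subrr mem0v.
rewrite refl_prod_cons act_mul -[v in v - _](subrK (v *m rG (val t))) -addrA.
rewrite span_cons memv_add ?IHτ // (act_refl _ _ rho_root) opprB addrCA subrr addr0.
by rewrite memvZ ?memv_line.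
Qed.

(** The remaining factors must undo the displacement caused by [t], but they move vectors only
    within a span that does not contain [rho t]; hence [t] already fixes [y]. *)
Lemma fixed_orthogonal (τ : seq refl) y : free (map rho τ) ->
  y *m rG (refl_prod τ) = y -> {in τ, forall t, dotv y (rho t) = 0}.
Proof.
elim: τ y => // t τ IHτ y; rewrite refl_prod_cons act_mul free_cons.
move=> /andP[tNs fτ] fixy.
have yt : dotv y (rho t) = 0.
  have := move_span τ (y *m rG (val t)); rewrite fixy (act_refl _ _ rho_root).
  rewrite addrAC subrr sub0r => ys; apply/eqP; apply: contraNT tNs => y0.
  move: ys; rewrite -scaleNr => ys.
  rewrite -[rho t]scale1r -(mulVf (x := - (2 * dotv y (rho t) / dotv (rho t) (rho t)))).
    by rewrite -scalerA memvZ.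
  by rewrite oppr_eq0 !mulf_neq0 ?invr_eq0 ?pnatr_eq0 // gt_eqF ?root_gt0.
have ty : y *m rG (val t) = y.
  by rewrite (act_refl _ _ rho_root) yt mulr0 mul0r scale0r subr0.
by move=> u; rewrite inE => /predU1P[->//|]; apply: IHτ => //; rewrite -{1}ty.
Qed.

Lemma simple_free : free (map rho s).
Proof.
case: s_simple => _ fr _; rewrite -(perm_free (X := [seq rho t | t in S])) //.
apply: perm_map; apply: uniq_perm; rewrite ?enum_uniq // => t.
by rewrite mem_enum inE.
Qed.

Lemma spanning_of_dim (τ : seq refl) : size τ = n -> free (map rho τ) ->
  <<map rho τ>>%VS = fullv.
Proof.
move=> sτ fr; apply/eqP; rewrite eqEdim subvf /=.
move: fr; rewrite /free size_map sτ => /eqP->.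
by rewrite dimvf dim_matrix mul1r.
Qed.

Lemma fixed_c (y : 'rV[R]_n) : y *m rG c = y -> y = 0.
Proof.
rewrite cE => /(fixed_orthogonal simple_free) yS; apply: dotvv_eq0.
have : y \in <<map rho s>>%VS.
  by rewrite spanning_of_dim ?size_tuple ?memvf // simple_free.
move=> /(@coord_span _ _ _ (in_tuple _)) yE; rewrite {2}yE dotv_sumr big1 // => i _.
rewrite dotvZr /=.
have /mapP[t ts ->] : (map rho s)`_i \in map rho s by apply: mem_nth.
by rewrite yS ?mulr0.
Qed.

(* Every factorization of c into n reflections is a triangular basis for [euler]. *)
Definition euler_mx : 'M[R]_n := invmx (1%:M - rG c).
Definition euler (x y : 'rV[R]_n) : R := dotv (y *m euler_mx) x.

Lemma euler_mxK (y : 'rV[R]_n) : y *m euler_mx - y *m euler_mx *m rG c = y.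
Proof.
have U : 1%:M - rG c \in unitmx.
  rewrite -row_free_unit; apply: inj_row_free => v; rewrite mulmxBr mulmx1.
  by move=> /eqP; rewrite subr_eq0 => /eqP /esym /fixed_c.
by rewrite -[X in X - _]mulmx1 -mulmxBr mulmxKV.
Qed.

Lemma eulerDr x y y' : euler x (y + y') = euler x y + euler x y'.
Proof. by rewrite /euler mulmxDl dotvDl. Qed.
Lemma eulerZr a x y : euler x (a *: y) = a * euler x y.
Proof. by rewrite /euler -scalemxAl dotvZl. Qed.
Lemma eulerNr x y : euler x (- y) = - euler x y.
Proof. by rewrite /euler mulNmx dotvNl. Qed.
Lemma euler_sumr (I : Type) (r : seq I) (P : pred I) (F : I -> 'rV[R]_n) x :
  euler x (\sum_(i <- r | P i) F i) = \sum_(i <- r | P i) euler x (F i).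
Proof. by rewrite /euler mulmx_suml dotv_suml. Qed.

(** For [x = p (1 - c)] and [y = q (1 - c)] this is the invariance of the scalar product under c. *)
Lemma euler_sym x y : euler x y + euler y x = dotv x y.
Proof.
have H (p q : 'rV[R]_n) : dotv q (p - p *m rG c) + dotv p (q - q *m rG c)
    = dotv (p - p *m rG c) (q - q *m rG c).
  by rewrite !dotvE dotv_act !(dotvC q); ring.
by have := H (x *m euler_mx) (y *m euler_mx); rewrite !euler_mxK.
Qed.

Lemma euler_self x : euler x x = dotv x x / 2.
Proof. by rewrite -euler_sym; field. Qed.

Lemma euler_gt0 t : 0 < euler (rho t) (rho t).
Proof. by rewrite euler_self divr_gt0 ?root_gt0. Qed.

(** The image of the invertible map 1 - c lies in the span of the roots of [τ], so these [n] roots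
    span the space. *)
Lemma full_free (τ : seq refl) : size τ = n -> c = refl_prod τ -> free (map rho τ).
Proof.
move=> sτ cτ; rewrite /free size_map sτ.
suff -> : <<map rho τ>>%VS = fullv by rewrite dimvf dim_matrix mul1r.
apply/eqP; rewrite eqEsubv subvf /=; apply/subvP => v _.
by rewrite -(euler_mxK v) cτ move_span.
Qed.

(** Put [y = (1 - c)^-1 u]. The displacement of [y] by [τ1] lies in the span of [τ1]. Since the
    total displacement is the root of [u], it also lies in the span of [τ2]. The two spans meet in
    0, so [τ1] fixes [y]. *)
Lemma full_euler (τ1 τ2 : seq refl) : size (τ1 ++ τ2) = n ->
  c = refl_prod (τ1 ++ τ2) ->
  {in τ1 & τ2, forall t u, euler (rho t) (rho u) = 0}.
Proof.
move=> sτ cτ t u t1 u2; have := full_free sτ cτ; rewrite map_cat cat_free.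
case/and3P=> f1 f2 /directv_addP dir; rewrite /euler; set y := _ *m _.
apply: (fixed_orthogonal f1) => //; apply/eqP; rewrite eq_sym -subr_eq0.
rewrite -memv0 -dir memv_cap move_span /=.
have := euler_mxK (rho u); rewrite -/y cτ refl_prod_cat act_mul.
set y1 := y *m rG (refl_prod τ1); rewrite -[y in y - _ = _](subrK y1) -addrA.
move=> /(canRL (addrK _)) ->; rewrite memvB ?move_span //.
by apply: memv_span; apply: map_f.
Qed.

Lemma refl_length_le (τ : seq refl) : (refl_length rG (refl_prod τ) <= size τ)%N.
Proof.
have H : is_refl_prod rG (refl_prod τ) (size τ).
  by apply/existsP; exists (in_tuple τ).
rewrite /refl_length; case: pselect => [ex|[]]; last by exists (size τ).
by case: ex_minnP => m _; apply.
Qed.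

Lemma refl_length_ex g :
  exists2 τ : seq refl, size τ = refl_length rG g & refl_prod τ = g.
Proof.
rewrite /refl_length; case: pselect => [ex|[]].
  case: ex_minnP => m /existsP[τ /eqP E] _.
  by exists τ; rewrite ?size_tuple.
elim/refl_generated: g => [|t g [m /existsP[τ /eqP E]]].
  by exists 0%N; apply/existsP; exists [tuple]; rewrite /= refl_prod_nil.
exists m.+1; apply/existsP; exists [tuple of t :: τ].
by rewrite /= refl_prod_cons E.
Qed.

Lemma refl_length_mul g1 g2 :
  (refl_length rG (g1 * g2)%g <= refl_length rG g1 + refl_length rG g2)%N.
Proof.
have [τ1 <- <-] := refl_length_ex g1; have [τ2 <- <-] := refl_length_ex g2.
by rewrite -refl_prod_cat -size_cat refl_length_le.
Qed.

Lemma refl_length_c : refl_length rG c = n.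
Proof.
apply/eqP; rewrite eqn_leq; apply/andP; split.
  by apply: leq_trans (eq_leq (size_tuple s)); rewrite cE refl_length_le.
have [τ <- cτ] := refl_length_ex c.
have dn : \dim (fullv : {vspace 'rV[R]_n}) = n by rewrite dimvf dim_matrix mul1r.
apply: leq_trans (eq_leq (esym dn)) _; rewrite -(size_map rho).
apply: leq_trans (dim_span _); apply: dimvS.
by apply/subvP => v _; rewrite -(euler_mxK v) -cτ move_span.
Qed.

Lemma refl_length_val t : refl_length rG (val t) = 1%N.
Proof.
have := refl_length_le [:: t]; rewrite refl_prod_cons refl_prod_nil mulg1 /=.
have [τ] := refl_length_ex (val t); case: (refl_length _ _) => [|[|//]] //.
by move=> /size0nil -> /eqP; rewrite refl_prod_nil eq_sym (negPf (val_neq1 t)).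
Qed.

Definition fact (τ : seq refl) := NC rG c (size τ) (refl_prod τ).

Lemma fact_length τ : fact τ -> refl_length rG (refl_prod τ) = size τ.
Proof. by case/andP=> _ /eqP. Qed.

(** Completion makes [full_free] and [full_euler] available; conversely, subadditivity of length and
    [refl_length_c] leave no slack. *)
Lemma factP τ : fact τ <-> exists τ', size (τ ++ τ') = n /\ c = refl_prod (τ ++ τ').
Proof.
split=> [/andP[/eqP lc /eqP lw]|[τ' [sz cτ]]].
  have [τ' sτ' pτ'] := refl_length_ex ((refl_prod τ)^-1 * c)%g; exists τ'.
  by rewrite size_cat sτ' refl_prod_cat pτ' mulKVg -lw lc refl_length_c.
have := refl_length_mul (refl_prod τ) (refl_prod τ').
have l1 := refl_length_le τ; have l2 := refl_length_le τ'.
have e : ((refl_prod τ)^-1 * c = refl_prod τ')%g by rewrite cτ refl_prod_cat mulKg.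
rewrite -refl_prod_cat -cτ /fact /NC /leT e refl_length_c.
by move: sz; rewrite size_cat; lia.
Qed.

Lemma fact_euler τ : fact τ -> pairwise (fun t u => euler (rho t) (rho u) == 0) τ.
Proof.
move=> /factP[τ' [sz cτ]].
case: τ sz cτ => // t0 τ sz cτ; apply/(pairwiseP t0) => i j; rewrite !inE => si sj ij.
set σ := t0 :: τ in sz cτ si sj *; apply/eqP.
rewrite -(cat_take_drop j σ) -catA in sz cτ.
apply: (full_euler sz cτ).
  by rewrite -(nth_take t0 ij) mem_nth // size_take sj.
by rewrite mem_cat -[j in nth t0 σ j]addn0 -nth_drop mem_nth // size_drop subn_gt0.
Qed.

(** Hurwitz moves: a skipped letter [x] is carried past the selected ones by [x g = g x^g], which
    keeps it a reflection. *)
Lemma hurwitz_subseq (σ τ : seq refl) : subseq σ τ ->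
  exists2 σ', size (σ ++ σ') = size τ & refl_prod τ = refl_prod (σ ++ σ').
Proof.
elim: τ σ => [|x τ IHτ] [|y σ] //; first by exists [::].
  by exists (x :: τ).
rewrite [subseq _ _]/=; case: eqP => [-> /IHτ[σ' sz pE]|_ /IHτ[σ' sz pE]].
  by exists σ'; rewrite /= ?sz // -cat_cons !refl_prod_cons pE.
exists (conjr x (refl_prod (y :: σ)) :: σ').
  by rewrite [RHS]/= -sz !size_cat /= addnS.
rewrite [LHS]refl_prod_cons pE refl_prod_cat [RHS]refl_prod_cat.
rewrite [X in _ = (_ * X)%g]refl_prod_cons.
rewrite val_conjr conjgE.
by rewrite !mulgA mulgV mul1g.
Qed.

Lemma fact_subseq σ τ : subseq σ τ -> fact τ -> fact σ.
Proof.
move=> /hurwitz_subseq[σ' sz pE] /factP[τ' [sz' cτ]]; apply/factP.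
exists (σ' ++ τ'); rewrite catA; split.
  by rewrite size_cat sz -size_cat.
by rewrite refl_prod_cat -pE -refl_prod_cat.
Qed.

Lemma fact_uniq τ : fact τ -> uniq τ.
Proof.
move=> /fact_euler; apply: pairwise_uniq => t.
by rewrite gt_eqF ?euler_gt0.
Qed.

Lemma fact_free τ : fact τ -> free (map rho τ).
Proof.
move=> /factP[τ' [sz cτ]]; have := full_free sz cτ.
by rewrite map_cat cat_free => /and3P[].
Qed.

Lemma fact_replace τ1 σ σ' τ2 : refl_prod σ = refl_prod σ' -> size σ = size σ' ->
  fact (τ1 ++ σ ++ τ2) -> fact (τ1 ++ σ' ++ τ2).
Proof. by move=> pE sE; rewrite /fact !refl_prod_cat !size_cat pE sE. Qed.

(** * Reflection orderings in rank 2 *)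

Variable prec : rel refl.
Hypothesis prec_refl : reflection_ordering rho S prec.

Lemma prec_irr : irreflexive prec. Proof. by case: prec_refl => -[]. Qed.
Lemma prec_trans : transitive prec. Proof. by case: prec_refl => -[]. Qed.
Lemma prec_total t u : t != u -> prec t u || prec u t.
Proof. by case: prec_refl => -[_ _ H] _; apply: H. Qed.

Lemma prec_asym t u : prec t u -> ~~ prec u t.
Proof. by move=> tu; apply/negP => /(prec_trans tu); rewrite prec_irr. Qed.

Lemma prec_neq t u : prec t u -> t != u.
Proof. by apply: contraTneq => ->; rewrite prec_irr. Qed.

Definition rank t := #|[set u | prec u t]%SET|.

Lemma rank_lt t u : prec t u -> (rank t < rank u)%N.
Proof.
move=> tu; apply: proper_card; apply/fintype.properP; split.
  by apply/fintype.subsetP => w; rewrite !inE => /prec_trans; apply.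
by exists t; rewrite !inE ?prec_irr.
Qed.

Lemma prec_max (P : pred refl) t0 : P t0 ->
  exists2 t, P t & forall u, P u -> ~~ prec t u.
Proof.
move=> Pt0; case: (@arg_maxnP _ t0 P rank Pt0) => t Pt tmax; exists t => // u Pu.
by apply/negP => /rank_lt; rewrite ltnNge; apply/negP/negPn/tmax.
Qed.

Lemma prec_sorted_uniq l : sorted prec l -> uniq l.
Proof. exact: (sorted_uniq prec_trans prec_irr). Qed.

Lemma pair_indep t u x y : t != u -> x *: rho t + y *: rho u = 0 -> x = 0 /\ y = 0.
Proof.
move=> tu E; have x0 : x = 0.
  apply/eqP; apply: contraNT tu => x0; apply/eqP.
  apply: (@root_inj _ _ _ (- (x^-1 * y)) rho_root).
  rewrite scaleNr -scalerA -[LHS]scale1r -(mulVf x0) -scalerA -scalerN.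
  by congr (_ *: _); apply/eqP; rewrite -addr_eq0 E.
split=> //; move/eqP: E; rewrite x0 scale0r add0r scaler_eq0.
by rewrite (negPf (root_neq0 u rho_root)) orbF => /eqP.
Qed.

Lemma pair_indep_eq t u x y x' y' : t != u ->
  x *: rho t + y *: rho u = x' *: rho t + y' *: rho u -> x = x' /\ y = y'.
Proof.
move=> tu E; have [] := @pair_indep t u (x - x') (y - y') tu.
  by rewrite !scalerBl addrACA -opprD E subrr.
by move=> /eqP; rewrite subr_eq0 => /eqP-> /eqP; rewrite subr_eq0 => /eqP->.
Qed.

(** The relation at an entry equates two consecutive products; at the first entry, the cyclic [prev]
    is the last one. *)
Lemma rotation_constant (t0 : refl) (l : seq refl) : uniq l -> (1 < size l)%N ->
  {in l, forall t, (val (next l t) * val t = val t * val (prev l t))%g} ->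
  forall i, (i.+1 < size l)%N ->
    (val (nth t0 l i.+1) * val (nth t0 l i) = val (nth t0 l 0) * val (nth t0 l (size l).-1))%g.
Proof.
move=> ul s1 H; elim=> [|i IHi] si.
  by have := H _ (mem_nth t0 (ltnW s1)); rewrite next_nthS // prev_nth0 // ltnW.
rewrite -(IHi (ltnW si)); have := H _ (mem_nth t0 (ltnW si)).
by rewrite next_nthS // prev_nthS // ltnW.
Qed.

(* [pl_area] says that the roots of the plane are listed in angular order, from *)
(* one simple root to the other.                                                *)
Record plane_seq (t u : refl) (l : seq refl) (X Y : refl -> R) : Prop := PlaneSeq {
  pl_sorted : sorted prec l;
  pl_size : (1 < size l)%N;
  pl_mem : forall r, r \in l <-> in_plane t u r;
  pl_coord : {in l, forall r, [/\ 0 <= X r, 0 <= Y r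
    & rho r = X r *: rho (nth t l 0) + Y r *: rho (nth t l (size l).-1)]};
  pl_prod : forall i, (i.+1 < size l)%N ->
    (val (nth t l i.+1) * val (nth t l i)
      = val (nth t l 0) * val (nth t l (size l).-1))%g;
  pl_area : forall i k, (i < k)%N -> (k < size l)%N ->
    0 < X (nth t l i) * Y (nth t l k) - Y (nth t l i) * X (nth t l k) }.

Section Area.
Variables (t : refl) (l : seq refl) (X Y : refl -> R).
Hypothesis ul : uniq l.
Hypothesis s1 : (1 < size l)%N.
Local Notation a := (nth t l 0).
Local Notation b := (nth t l (size l).-1).
Hypothesis coord : {in l, forall r, [/\ 0 <= X r, 0 <= Y r
  & rho r = X r *: rho a + Y r *: rho b]}.
Hypothesis prodE : forall i, (i.+1 < size l)%N ->
  (val (nth t l i.+1) * val (nth t l i) = val a * val b)%g.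

Lemma seq_size_gt0 : (0 < size l)%N. Proof. exact: ltnW. Qed.

Lemma ends_neq : a != b.
Proof. by rewrite nth_uniq ?ltn_predL ?seq_size_gt0 // neq_ltn ltn_predRL s1. Qed.

Lemma coordX_gt0 i : (i.+1 < size l)%N -> 0 < X (nth t l i).
Proof.
move=> si; have [x0 _ E] := coord (mem_nth t (ltnW si)).
rewrite lt_def x0 andbT; apply/eqP => X0; move: E; rewrite X0 scale0r add0r.
by move=> /(root_inj rho_root)/eqP; rewrite nth_uniq ?ltn_predL ?seq_size_gt0 ?(ltnW si) //;
   rewrite ltn_eqF ?ltn_predRL.
Qed.

Lemma coordY_gt0 i : (0 < i)%N -> (i < size l)%N -> 0 < Y (nth t l i).
Proof.
move=> i0 si; have [_ x0 E] := coord (mem_nth t si).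
rewrite lt_def x0 andbT; apply/eqP => X0; move: E; rewrite X0 scale0r addr0.
by move=> /(root_inj rho_root)/eqP; rewrite nth_uniq ?seq_size_gt0 // gtn_eqF.
Qed.

(* A vector [v] of the plane orthogonal to the root of [l_(i+1)] is moved by    *)
(* the rotation [l_(i+1) l_i = a b] along the root of [l_i]; computing this     *)
(* displacement from [a b] gives the sign.                                     *)
Lemma area_succ i : (i.+1 < size l)%N ->
  0 < X (nth t l i) * Y (nth t l i.+1) - Y (nth t l i) * X (nth t l i.+1).
Proof.
move=> si; set q := nth t l i; set p := nth t l i.+1.
have [_ _ qE] := coord (mem_nth t (ltnW si)).
have [_ _ pE] := coord (mem_nth t si).
rewrite -/q in qE; rewrite -/p in pE.
have Xq : 0 < X q := coordX_gt0 si.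
have Yp : 0 < Y p := coordY_gt0 (ltn0Sn i) si.
pose q1 := dotv (rho a) (rho a); pose q2 := dotv (rho b) (rho b).
pose g := dotv (rho a) (rho b).
have q1_gt0 : 0 < q1 := root_gt0 a rho_root.
have q2_gt0 : 0 < q2 := root_gt0 b rho_root.
have G_gt0 : 0 < q1 * q2 - g ^+ 2.
  have : 0 < dotv (q1 *: rho b + (- g) *: rho a) (q1 *: rho b + (- g) *: rho a).
    apply: dotvv_gt0; apply/eqP => E; have ba : b != a by rewrite eq_sym ends_neq.
    have [q10 _] := pair_indep ba E.
    by move: q1_gt0; rewrite q10 ltxx.
  rewrite !dotvE (dotvC (rho b) (rho a)) -/q1 -/q2 -/g.
  rewrite [X in 0 < X](_ : _ = q1 * (q1 * q2 - g ^+ 2)); last by ring.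
  by rewrite pmulr_rgt0.
set G := q1 * q2 - g ^+ 2 in G_gt0.
(* Solved from the Gram matrix of [a, b], of determinant [G], so that the pairings with [a] and [b]
   are [Y p * G] and [- (X p * G)]. *)
pose v := (Y p * q2 + X p * g) *: rho a + (- (X p * q1 + Y p * g)) *: rho b.
have va : dotv v (rho a) = Y p * G.
  by rewrite !dotvE (dotvC (rho b) (rho a)) -/q1 -/q2 -/g /G; ring.
have vb : dotv v (rho b) = - (X p * G).
  by rewrite !dotvE -/q1 -/q2 -/g /G; ring.
clearbody v.
have vp : dotv v (rho p) = 0 by rewrite pE dotvDr !dotvZr va vb; ring.
have vq : dotv v (rho q) = (X q * Y p - Y q * X p) * G.
  by rewrite qE dotvDr !dotvZr va vb; ring.
have := congr1 (fun g => v *m rG g) (prodE si).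
rewrite -/p -/q !act_mul !(act_refl _ _ rho_root) vp mulr0 mul0r scale0r subr0.
rewrite vq -addrA => /addrI; rewrite -opprD => /oppr_inj.
rewrite [X in _ *: X = _]qE scalerDr !scalerA => /(pair_indep_eq ends_neq)[E _].
rewrite va -/q1 in E.
have : 0 < (2 * ((X q * Y p - Y q * X p) * G) / dotv (rho q) (rho q)) * X q.
  by rewrite E divr_gt0 // mulr_gt0 // mulr_gt0.
rewrite pmulr_lgt0 // pmulr_lgt0 ?invr_gt0 ?root_gt0 // pmulr_rgt0 //.
by rewrite pmulr_lgt0.
Qed.

(** Writing A for the area, [Y_k A(i, m) = Y_m A(i, k) + Y_i A(k, m)]. Since [Y_k > 0] for [k > 0],
    positivity propagates from consecutive entries. *)
Lemma area_lt i k : (i < k)%N -> (k < size l)%N ->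
  0 < X (nth t l i) * Y (nth t l k) - Y (nth t l i) * X (nth t l k).
Proof.
elim: k => // k IHk; rewrite ltnS leq_eqVlt => /predU1P[->|ik] sk.
  exact: area_succ.
have kI := IHk ik (ltnW sk); have kS := area_succ sk.
have Yk : 0 < Y (nth t l k) by apply: coordY_gt0; rewrite ?(ltnW sk) //; lia.
have Yk' : 0 < Y (nth t l k.+1) by apply: coordY_gt0.
have [_ Yi _] := coord (mem_nth t (ltn_trans ik (ltnW sk))).
rewrite -(pmulr_rgt0 _ Yk).
set Xi := X _ in kI *; set Yi' := Y (nth t l i) in Yi kI *.
set Xk := X (nth t l k) in kI kS *; set Yk1 := Y (nth t l k) in Yk kI kS *.
set Xm := X _ in kS *; set Ym := Y _ in Yk' kS *.
have -> : Yk1 * (Xi * Ym - Yi' * Xm)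
  = Ym * (Xi * Yk1 - Yi' * Xk) + Yi' * (Xk * Ym - Yk1 * Xm) by ring.
by rewrite ltr_pwDl ?mulr_gt0 // mulr_ge0 // ltW.
Qed.

End Area.

Lemma plane_seq_ex t u : t != u -> exists l X Y, plane_seq t u l X Y.
Proof.
move=> tu; have [P [P2 PP]] := plane_parabolic tu.
have [u1 [um [us]]] := (prec_refl.2 P P2).
set TP := [set t : refl | val t \in P]%SET; set l0 := u1 :: rcons us um.
move=> [ul0 l0P [_ _ sc] rot so].
have l0m r : r \in l0 <-> in_plane t u r by rewrite l0P inE.
have s1 : (1 < size l0)%N by rewrite /= size_rcons.
have e0 : nth t l0 0 = u1 by [].
have em : nth t l0 (size l0).-1 = um.
  by rewrite /= size_rcons /= -cats1 nth_cat ltnn subnn.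
have u1m : u1 != um by rewrite -e0 -em nth_uniq // /= size_rcons.
have /choice[XY XYP] : forall r, exists xy : R * R, r \in l0 ->
    [/\ 0 <= xy.1, 0 <= xy.2 & rho r = xy.1 *: rho u1 + xy.2 *: rho um].
  move=> r; have [rl|rl] := boolP (r \in l0); last by exists (0, 0).
  have [|a a0 aE] := sc r; first by rewrite -l0P.
  by exists (a u1, a um); split; rewrite /= ?a0 // aE big_setU1 ?inE //= big_set1.
have prod0 := rotation_constant t ul0 s1 rot.
case/orP: so => so.
  exists l0, (fun r => (XY r).1), (fun r => (XY r).2).
  have co : {in l0, forall r, [/\ 0 <= (XY r).1, 0 <= (XY r).2
      & rho r = (XY r).1 *: rho (nth t l0 0) + (XY r).2 *: rho (nth t l0 (size l0).-1)]}.
    by move=> r /XYP; rewrite e0 em.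
  by split=> //; apply: (area_lt ul0 s1 co prod0).
(* In the decreasing case the list is reversed: the two coordinates are exchanged and the products
   inverted. *)
pose l := rev l0; have sl : size l = size l0 by rewrite size_rev.
have f0 : nth t l 0 = um.
  by rewrite nth_rev ?subn1 ?em // ltnW.
have fm : nth t l (size l).-1 = u1.
  by rewrite sl nth_rev ?ltn_predL ?prednK ?subnn // ltnW.
have co : {in l, forall r, [/\ 0 <= (XY r).2, 0 <= (XY r).1
      & rho r = (XY r).2 *: rho (nth t l 0) + (XY r).1 *: rho (nth t l (size l).-1)]}.
  by move=> r; rewrite mem_rev => /XYP[? ? ->]; rewrite f0 fm addrC.
have prodl i : (i.+1 < size l)%N ->
    (val (nth t l i.+1) * val (nth t l i)
      = val (nth t l 0) * val (nth t l (size l).-1))%g.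
  rewrite f0 fm sl => si; rewrite !nth_rev ?(ltnW si) //.
  have := prod0 (size l0 - i.+2)%N; rewrite e0 em.
  rewrite (_ : (size l0 - i.+2).+1 = (size l0 - i.+1)%N); last by move: si; lia.
  move=> /(_ _)/(congr1 (fun g => g^-1)%g); rewrite !invMg !val_inv; apply.
  by move: si; lia.
have ul : uniq l by rewrite rev_uniq.
exists l, (fun r => (XY r).2), (fun r => (XY r).1); split=> //.
- by rewrite sl.
- by move=> r; rewrite mem_rev.
- by apply: (area_lt ul _ co prodl); rewrite sl.
Qed.

Lemma pl_uniq t u l X Y : plane_seq t u l X Y -> uniq l.
Proof. by move=> H; apply: prec_sorted_uniq (pl_sorted H). Qed.

Lemma pl_sortedP t u l X Y i k : plane_seq t u l X Y ->
  (i < size l)%N -> (k < size l)%N -> prec (nth t l i) (nth t l k) = (i < k)%N.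
Proof.
move=> H si sk; have so := pl_sorted H.
have mono i' k' : (i' < k')%N -> (k' < size l)%N -> prec (nth t l i') (nth t l k').
  move=> ik' sk'; apply: (sorted_ltn_nth prec_trans t so) => //.
  by rewrite inE (ltn_trans ik').
have [ik|ki|->] := ltngtP i k; first exact: mono.
  by apply/negbTE; apply: prec_asym; apply: mono.
exact: prec_irr.
Qed.

Lemma plane_seq_ends t u l X Y : plane_seq t u l X Y ->
  [/\ X (nth t l 0) = 1, Y (nth t l 0) = 0, X (nth t l (size l).-1) = 0
    & Y (nth t l (size l).-1) = 1].
Proof.
move=> H; have s1 := pl_size H; have ab := @ends_neq t l (pl_uniq H) s1.
have [_ _ E0] := pl_coord H (mem_nth t (ltnW s1)).
have lm : ((size l).-1 < size l)%N by move: s1; lia.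
have [_ _ E1] := pl_coord H (mem_nth t lm).
have [] := @pair_indep_eq _ _ 1 0 _ _ ab (etrans _ E0).
  by rewrite scale1r scale0r addr0.
have [] := @pair_indep_eq _ _ 0 1 _ _ ab (etrans _ E1).
  by rewrite scale1r scale0r add0r.
by move=> <- <- <- <-.
Qed.

(** Within the plane, [prec] is the sign of the area. By bilinearity, the areas of [t] with [a] and
    with [b] are positive multiples of that of [a] and [b], up to orientation. *)
Lemma prec_convex a b t x y : a != b -> 0 < x -> 0 < y ->
  rho t = x *: rho a + y *: rho b ->
  prec a t && prec t b || prec b t && prec t a.
Proof.
move=> ab x0 y0 tE; have [l [X [Y H]]] := plane_seq_ex ab.
have al : a \in l by apply/(pl_mem H); exists 1, 0; rewrite scale1r scale0r addr0.
have bl : b \in l by apply/(pl_mem H); exists 0, 1; rewrite scale1r scale0r add0r.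
have tl : t \in l by apply/(pl_mem H); exists x, y.
have s1 := pl_size H; have uab := @ends_neq a l (pl_uniq H) s1.
have [_ _ aE] := pl_coord H al; have [_ _ bE] := pl_coord H bl.
have [_ _ tE'] := pl_coord H tl.
have [Xt Yt] : X t = x * X a + y * X b /\ Y t = x * Y a + y * Y b.
  apply: (pair_indep_eq uab); rewrite -tE' tE {1}aE {1}bE.
  by apply/rowP => i; rewrite !mxE; ring.
have dec r q : r \in l -> q \in l -> 0 < X r * Y q - Y r * X q -> prec r q.
  move=> rl ql; rewrite -(nth_index a rl) -(nth_index a ql).
  set i := index r l; set k := index q l.
  have si : (i < size l)%N by rewrite index_mem.
  have sk : (k < size l)%N by rewrite index_mem.
  rewrite (pl_sortedP H) //; case: ltngtP => // [ki|->].
    by have := pl_area H ki si; rewrite [X in _ -> X < _ -> _]/=; lra.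
  by rewrite mulrC subrr ltxx.
have area r q : r \in l -> q \in l -> prec r q -> 0 < X r * Y q - Y r * X q.
  move=> rl ql; rewrite -(nth_index a rl) -(nth_index a ql).
  set i := index r l; set k := index q l.
  have si : (i < size l)%N by rewrite index_mem.
  have sk : (k < size l)%N by rewrite index_mem.
  by rewrite (pl_sortedP H) // => ik; apply: (pl_area H).
case/orP: (prec_total ab) => pab; [have D := area _ _ al bl pab|have D := area _ _ bl al pab].
  apply/orP; left; apply/andP; split; apply: dec => //; rewrite Xt Yt.
    rewrite (_ : _ - _ = y * (X a * Y b - Y a * X b)); last by ring.
    by rewrite mulr_gt0.
  rewrite (_ : _ - _ = x * (X a * Y b - Y a * X b)); last by ring.
  by rewrite mulr_gt0.
apply/orP; right; apply/andP; split; apply: dec => //; rewrite Xt Yt.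
  rewrite (_ : _ - _ = x * (X b * Y a - Y b * X a)); last by ring.
  by rewrite mulr_gt0.
rewrite (_ : _ - _ = y * (X b * Y a - Y b * X a)); last by ring.
by rewrite mulr_gt0.
Qed.

(** * Factorizations of the elements of length 2 below c *)

Hypothesis prec_compatible : c_compatible c prec.

Lemma fact2_eq t u x y : fact [:: t; u] -> (val x * val y = val t * val u)%g ->
  fact [:: x; y].
Proof. by move=> f E; rewrite /fact refl_prod2 E -refl_prod2. Qed.

Lemma fact2_neq t u : fact [:: t; u] -> t != u.
Proof. by move=> /fact_uniq /= /andP[]; rewrite inE. Qed.

Lemma fact2_euler t u : fact [:: t; u] -> euler (rho t) (rho u) = 0.
Proof. by move=> /fact_euler /= /andP[/andP[/eqP]]. Qed.

Lemma rotation_closed t u l X Y (r0 := (val (nth t l 0) * val (nth t l (size l).-1))%g) :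
  plane_seq t u l X Y -> {in l, forall x,
    (exists2 x', x' \in l & (val x * r0 = val x')%g) /\
    (exists2 x', x' \in l & (val x * r0^-1 = val x')%g)}.
Proof.
move=> H x xl; have s1 := pl_size H.
have lm : ((size l).-1 < size l)%N by rewrite ltn_predL ltnW.
rewrite -(nth_index t xl); have : (index x l < size l)%N by rewrite index_mem.
move: (index x l) => i si; split.
  case: i si => [|i] si.
    by exists (nth t l (size l).-1); rewrite ?mem_nth // /r0 mulgA val_sqr mul1g.
  exists (nth t l i); first by rewrite mem_nth // ltnW.
  by rewrite /r0 -(pl_prod H si) mulgA val_sqr mul1g.
have [si'|] := ltnP i.+1 (size l).
  exists (nth t l i.+1); first by rewrite mem_nth.
  by rewrite /r0 -(pl_prod H si') invMg !val_inv mulgA val_sqr mul1g.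
move=> si'; have -> : i = (size l).-1.
  by apply/eqP; rewrite eqn_leq -ltnS prednK ?(ltnW s1) // si -ltnS prednK ?(ltnW s1).
exists (nth t l 0); first by rewrite mem_nth // ltnW.
by rewrite /r0 invMg !val_inv mulgA val_sqr mul1g.
Qed.

(** Dihedral structure: [l_i = r0^i l_0], so [y z] is a power of the rotation [r0], and such powers
    permute the reflections of the plane. *)
Lemma plane_mul_closed t u l X Y : plane_seq t u l X Y ->
  {in l & &, forall x y z, exists2 x', x' \in l & (val x * (val y * val z) = val x')%g}.
Proof.
move=> H x y z xl yl zl; pose r0 := (val (nth t l 0) * val (nth t l (size l).-1))%g.
have powE i : (i < size l)%N -> (val (nth t l i) = r0 ^+ i * val (nth t l 0))%g.
  elim: i => [|i IHi] si; first by rewrite mul1g.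
  rewrite expgS -mulgA -IHi ?(ltnW si) // /r0 -(pl_prod H si) -mulgA val_sqr.
  by rewrite mulg1.
have yE := powE (index y l); have zE := powE (index z l).
rewrite !index_mem !nth_index // in yE zE.
have -> : (val y * val z = r0 ^+ index y l * r0^-1 ^+ index z l)%g.
  by rewrite -(val_inv z) yE // zE // invMg mulgA mulgK expVgn.
have mulX m (w : refl) : w \in l -> exists2 x', x' \in l & (val w * r0 ^+ m = val x')%g.
  move=> wl; elim: m => [|m [x' x'l IH]]; first by exists w; rewrite ?mulg1.
  have [[x'' x''l E] _] := rotation_closed H x'l.
  by exists x''; rewrite // expgSr mulgA IH E.
have mulV m (w : refl) : w \in l -> exists2 x', x' \in l & (val w * r0^-1 ^+ m = val x')%g.
  move=> wl; elim: m => [|m [x' x'l IH]]; first by exists w; rewrite ?mulg1.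
  have [_ [x'' x''l E]] := rotation_closed H x'l.
  by exists x''; rewrite // expgSr mulgA IH E.
have [x' x'l E] := mulX (index y l) x xl.
by have [x'' x''l E'] := mulV (index z l) x' x'l; exists x''; rewrite // mulgA E E'.
Qed.

(** This lets [c_compatible] be applied to planes. If [t u = r x], the component of [rho r]
    orthogonal to the plane is fixed by [t u], hence orthogonal to [rho r] by [fixed_orthogonal],
    hence zero. *)
Lemma plane_leT t u l X Y r : fact [:: t; u] -> plane_seq t u l X Y ->
  (r \in l) = leT rG (val r) (val t * val u)%g.
Proof.
move=> f H; have lw := fact_length f; rewrite refl_prod2 /= in lw.
have tl : t \in l by apply/(pl_mem H); exists 1, 0; rewrite scale1r scale0r addr0.
have ul : u \in l by apply/(pl_mem H); exists 0, 1; rewrite scale1r scale0r add0r.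
rewrite /leT refl_length_val lw val_inv; apply/idP/idP => [rl|].
  by have [x _ ->] := plane_mul_closed H rl tl ul; rewrite refl_length_val.
have [τ sτ pτ] := refl_length_ex (val r * (val t * val u))%g.
rewrite -sτ eqSS => /eqP; case: τ sτ pτ => [|x []] //= _ pτ _.
have wE : (val t * val u = val r * val x)%g.
  by rewrite -(mulg1 (val x)) -refl_prod_nil -refl_prod_cons pτ mulgA val_sqr mul1g.
have fr : fact [:: r; x] by apply: (fact2_eq f).
have [v [y1 [y2 [vt vu rE]]]] := orthogonal_part (rho t) (rho u) (rho r).
apply/(pl_mem H); exists y1, y2; rewrite rE -[RHS]add0r -addrA; congr (_ + _).
apply: dotvv_eq0; have fixv : v *m rG (refl_prod [:: r; x]) = v.
  rewrite refl_prod2 -wE act_mul !(act_refl _ _ rho_root) vt.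
  by rewrite mulr0 mul0r scale0r subr0 vu mulr0 mul0r scale0r subr0.
have := fixed_orthogonal (fact_free fr) fixv (mem_head _ _).
by rewrite rE !dotvE vt vu !mulr0 !addr0.
Qed.

Lemma nc2_seq t u : fact [:: t; u] -> exists l X Y,
  [/\ plane_seq t u l X Y,
      forall i, (i.+1 < size l)%N ->
        (val (nth t l i.+1) * val (nth t l i) = val t * val u)%g,
      (val (nth t l 0) * val (nth t l (size l).-1) = val t * val u)%g
    & forall x y : refl, (val x * val y = val t * val u)%g -> x \in l].
Proof.
move=> f; have [l [X [Y H]]] := plane_seq_ex (fact2_neq f).
exists l, X, Y; have s1 := pl_size H.
have ll : l =i [set r : refl | leT rG (val r) (val t * val u)%g]%SET.
  by move=> r; rewrite (plane_leT r f H) inE.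
have nc2 : NC rG c 2 (val t * val u)%g by rewrite -refl_prod2.
have cc := prec_compatible nc2 (pl_sorted H) ll.
have e0 : (val (nth t l 0) * val (nth t l (size l).-1) = val t * val u)%g.
  rewrite (cc (nth t l 0)) ?mem_nth ?(ltnW s1) //.
  by rewrite prev_nth0 ?(pl_uniq H) // ltnW.
split=> // [i si|x y E]; first by rewrite -e0 (pl_prod H si).
rewrite (plane_leT x f H) /leT -E mulKg !refl_length_val E.
by rewrite -(refl_prod2 t u) (fact_length f).
Qed.

(** The first letter and the product determine the second letter, and only the first letter [l_0]
    yields an ascent. *)
Lemma nc2_nth t u l X Y : fact [:: t; u] -> plane_seq t u l X Y ->
  (forall i, (i.+1 < size l)%N ->
    (val (nth t l i.+1) * val (nth t l i) = val t * val u)%g) ->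
  (val (nth t l 0) * val (nth t l (size l).-1) = val t * val u)%g ->
  if prec t u then t = nth t l 0 /\ u = nth t l (size l).-1
  else exists2 i, (i.+1 < size l)%N & t = nth t l i.+1 /\ u = nth t l i.
Proof.
move=> f H pS p0; have s1 := pl_size H.
have tl : t \in l by apply/(pl_mem H); exists 1, 0; rewrite scale1r scale0r addr0.
have lm : ((size l).-1 < size l)%N by rewrite ltn_predL ltnW.
have := nth_index t tl; have : (index t l < size l)%N by rewrite index_mem.
case: (index t l) => [|i] si tE.
  have uE : u = nth t l (size l).-1.
    by apply: val_inj; apply: (mulgI (val t)); rewrite -p0 tE.
  have : prec (nth t l 0) (nth t l (size l).-1).
    by rewrite (pl_sortedP H) ?(ltnW s1) // ltn_predRL s1.
  by rewrite tE -uE => ->.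
have uE : u = nth t l i.
  by apply: val_inj; apply: (mulgI (val t)); rewrite -(pS _ si) tE.
have : ~~ prec (nth t l i.+1) (nth t l i).
  by rewrite (pl_sortedP H) ?(ltnW si) // ltnNge leqnSn.
by rewrite tE -uE => /negPf->; exists i.
Qed.

(** Here [t] and [u] are the simple reflections of the plane. The image of [rho u] under [t] has
    coordinate 1 at [u], so it is a positive multiple of a positive root, and its coordinate [- d]
    at [t] is nonnegative. *)
Lemma nc2_ascent t u : fact [:: t; u] -> prec t u -> dotv (rho t) (rho u) <= 0.
Proof.
move=> f tu; have [l [X [Y [H pS p0 _]]]] := nc2_seq f.
have := nc2_nth f H pS p0; rewrite tu => -[tE uE].
have [x x0 xE] := root_conj u (val t) rho_root.
rewrite (act_refl _ _ rho_root) in xE; set d := _ / _ in xE.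
have ul : conjr u (val t) \in l.
  apply/(pl_mem H); exists (x^-1 * - d), x^-1.
  rewrite -scalerA -scalerDr addrC scaleNr xE scalerA mulVf //.
  by rewrite scale1r.
have [X0 Y0 E] := pl_coord H ul; rewrite -tE -uE in E.
have E2 : (- d) *: rho t + 1 *: rho u
    = (x * X (conjr u (val t))) *: rho t + (x * Y (conjr u (val t))) *: rho u.
  by rewrite scale1r addrC scaleNr xE {1}E scalerDr !scalerA.
have [Ed E1] := pair_indep_eq (fact2_neq f) E2.
have xp : 0 < x.
  rewrite lt_neqAle eq_sym x0 leNgt; apply/negP => xn.
  have : x * Y (conjr u (val t)) <= 0 by rewrite nmulr_rle0.
  by rewrite -E1 ler10.
have : d <= 0 by rewrite -oppr_ge0 Ed mulr_ge0 // ltW.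
by rewrite /d dotvC pmulr_lle0 ?invr_gt0 ?root_gt0 // pmulr_rle0.
Qed.

(** Since [euler (rho t) (rho u) = 0], the product is [euler (rho u) (rho t)]. The root of [t] is
    expanded in [u] and the predecessor of [u] in the cyclic list: the predecessor contributes 0,
    and the coefficient of [u] is nonnegative by the areas. *)
Lemma nc2_descent t u : fact [:: t; u] -> prec u t -> 0 <= dotv (rho t) (rho u).
Proof.
move=> f ut; have [l [X [Y [H pS p0 _]]]] := nc2_seq f.
have := nc2_nth f H pS p0; rewrite (negPf (prec_asym ut)) => -[i si [tE uE]].
rewrite -euler_sym (fact2_euler f) add0r.
have tl : t \in l by rewrite tE mem_nth.
case: i si tE uE => [|i] si tE uE.
  have [X0 _ ->] := pl_coord H tl; rewrite uE eulerDr !eulerZr.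
  rewrite (fact2_euler (fact2_eq f p0)) mulr0 addr0 mulr_ge0 // ltW //.
  exact: euler_gt0.
have [_ _ pE] := pl_coord H (mem_nth t (ltnW (ltnW si))).
have [_ _ qE] := pl_coord H (mem_nth t (ltnW si)).
have [_ _ rE] := pl_coord H (mem_nth t si).
have a1 := pl_area H (ltnSn i) (ltnW si).
have a2 := pl_area H (ltnW (ltnSn i.+1)) si.
have Epq := fact2_euler (fact2_eq f (pS _ (ltnW si))).
rewrite tE uE.
set p := nth t l i in pE a1 a2 Epq *; set q := nth t l i.+1 in qE a1 Epq *.
set r := nth t l i.+2 in rE a2 *.
have E : (X p * Y q - Y p * X q) *: rho r
    = (X r * Y q - Y r * X q) *: rho p + (X p * Y r - Y p * X r) *: rho q.
  by rewrite rE pE qE; apply/rowP => m; rewrite !mxE; ring.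
have := congr1 (euler (rho q)) E; rewrite eulerDr !eulerZr Epq mulr0 add0r => E'.
by rewrite -(pmulr_rge0 _ a1) E' mulr_ge0 ?(ltW a2) // ltW // euler_gt0.
Qed.

(** * Signs of the Euler form *)

Definition flip (A : {set refl}) t : 'rV[R]_n := if t \in A then - rho t else rho t.

Lemma flip_root A : root_choice (flip A).
Proof.
move=> t; rewrite /flip; case: ifP => _ //; have [t0 tE] := rho_root t.
by split; rewrite ?oppr_eq0 // -scaleN1r refl_mxZ // oppr_eq0 oner_eq0.
Qed.

Lemma free_indep τ : uniq τ -> free (map rho τ) -> indep rho [set t in τ]%SET.
Proof.
move=> ut fr; apply/indepP; rewrite (perm_free (Y := map rho τ)) //.
apply: perm_map; apply: uniq_perm; rewrite ?enum_uniq // => t.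
by rewrite mem_enum inE.
Qed.

Lemma indep_flip (A B : {set refl}) : indep rho B -> indep (flip A) B.
Proof.
move=> ind a a0 t tB.
have := ind (fun t => if t \in A then - a t else a t) _ t tB.
case: ifP => tA H; first apply: oppr_inj; rewrite ?oppr0; apply: H;
  rewrite -{}[RHS]a0; apply: eq_bigr => u _; rewrite /flip;
  by case: ifP => _; rewrite ?scalerN ?scaleNr.
Qed.

(* For an initial segment [A], [flip A] is again a positive system, and        *)
(* [flip_basis] says that c is a product of its simple reflections.            *)
Definition flip_basis (A : {set refl}) (τ : seq refl) :=
  [/\ size τ = n, c = refl_prod τ
    & forall t, cone (flip A) [set x in τ]%SET (flip A t)].

Section FlipStep.
Variables (b : refl) (τ : seq refl).
Local Notation A := [set t | prec t b]%SET.
Local Notation r := (flip A).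
Local Notation B := [set x in τ]%SET.
Hypothesis Aτ : flip_basis A τ.

Let r_root : root_choice r := flip_root A.

Lemma flip_first : r b = rho b.
Proof. by rewrite /flip inE prec_irr. Qed.

Lemma basis_fact : fact τ.
Proof.
case: Aτ => sz cτ _; apply/factP; exists [::].
by rewrite cats0.
Qed.

Lemma basis_cone t : cone r B (r t). Proof. by case: Aτ. Qed.

Lemma basis_indep : indep r B.
Proof.
by apply/indep_flip/free_indep; rewrite ?fact_uniq ?fact_free ?basis_fact.
Qed.

Lemma notin_prec t : t != b -> t \notin A -> prec b t.
Proof. by move=> /prec_total /orP[]; rewrite inE => ->. Qed.

(** Otherwise [r b] is a positive combination of two other roots of the flipped system. If both are
    flipped, the height of [rho b] is negative. In the other cases [prec_convex] contradicts that
    [A] consists of the predecessors of [b]. *)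
Lemma first_in_basis : b \in τ.
Proof.
apply: contraT => bN; have [a a0 aE] := basis_cone b.
have [t tB tb] : exists2 t, t \in B & 0 < dotv (r t) (r b).
  apply/exists_inP; rewrite -[X in is_true X]negbK; apply/negP => /exists_inPn H0.
  have := root_gt0 b r_root; rewrite {1}aE dotv_suml ltNge => /negP; apply.
  rewrite sumr_le0 // => i iI; rewrite dotvZl mulr_ge0_le0 // leNgt.
  exact: H0.
have bt : b != t by apply: contraNneq bN => ->; rewrite inE in tB.
have [x x0] := cone_act_simple r_root basis_indep basis_cone tB bt.
rewrite (act_refl _ _ r_root); set b' := conjr _ _; set d := _ / _.
have d0 : 0 < d by rewrite divr_gt0 ?root_gt0 // mulr_gt0 // dotvC.
move=> /(canRL (subrK _)); rewrite flip_first => bE.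
have b't : b' != t by apply: conjr_neq.
have b'b : b' != b.
  apply/eqP => E; case/eqP: bt; apply: esym.
  apply: (@root_inj r t b (d^-1 * (1 - x)) r_root); rewrite -scalerA.
  rewrite scalerBl scale1r flip_first {1}bE E flip_first addrAC subrr add0r.
  by rewrite scalerA mulVf ?gt_eqF // scale1r.
have [tA|tA] := boolP (t \in A); have [b'A|b'A] := boolP (b' \in A).
- have := height_gt0 b; rewrite bE /flip tA b'A !scalerN !dotvE.
  have := mulr_gt0 x0 (height_gt0 b'); have := mulr_gt0 d0 (height_gt0 t).
  by lra.
- have : rho b' = x^-1 *: rho b + (x^-1 * d) *: rho t.
    rewrite bE /flip tA (negPf b'A) -scalerA -scalerDr scalerN subrK scalerA.
    by rewrite mulVf ?gt_eqF // scale1r.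
  move=> /(prec_convex bt); rewrite invr_gt0 x0 mulr_gt0 ?invr_gt0 // => /(_ isT isT).
  rewrite !inE in tA b'A *; case/orP=> /andP[p1 p2]; last by rewrite p2 in b'A.
  by have := prec_trans p1 p2; rewrite (negPf (prec_asym tA)).
- have : rho t = d^-1 *: rho b + (d^-1 * x) *: rho b'.
    rewrite bE /flip b'A (negPf tA) -scalerA -scalerDr scalerN addrAC addNr add0r.
    by rewrite scalerA mulVf ?gt_eqF // scale1r.
  rewrite eq_sym in b'b.
  move=> /(prec_convex b'b); rewrite invr_gt0 d0 mulr_gt0 ?invr_gt0 // => /(_ isT isT).
  rewrite !inE in tA b'A *; case/orP=> /andP[p1 p2]; last by rewrite p2 in tA.
  by have := prec_trans p1 p2; rewrite (negPf (prec_asym b'A)).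
move: bE; rewrite /flip (negPf tA) (negPf b'A) => /(prec_convex b't).
move=> /(_ x0 d0); rewrite !inE in tA b'A.
by rewrite (negPf tA) (negPf b'A).
Qed.

Let bB : b \in B. Proof. by rewrite inE first_in_basis. Qed.

Lemma basis_obtuse t : t \in B -> t != b -> dotv (r t) (rho b) <= 0.
Proof.
move=> tB tb; have [x x0] := cone_act_simple r_root basis_indep basis_cone bB tb.
rewrite (act_refl _ _ r_root) flip_first; set d := _ / _.
have [a a0 ->] := basis_cone (conjr t (val b)); rewrite scaler_sumr => E.
have E' : \sum_(u in B) (x * a u) *: r u
    = \sum_(u in B) ((u == t)%:R - (u == b)%:R * d) *: r u.
  under eq_bigr do rewrite -scalerA; rewrite -{}E.
  under eq_bigr do rewrite scalerBl -scalerA.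
  rewrite sumrB (bigD1 t) //= eqxx scale1r big1 ?addr0; last first.
    by move=> u /andP[_ /negPf->]; rewrite scale0r.
  rewrite (bigD1 b) //= eqxx scale1r big1 ?addr0 ?flip_first //.
  by move=> u /andP[_ /negPf->]; rewrite scale0r.
have := indep_eq basis_indep E' bB; rewrite eq_sym (negPf tb) eqxx mul1r add0r => Ed.
have : d <= 0 by rewrite -oppr_ge0 -Ed mulr_ge0 // ltW.
by rewrite /d pmulr_lle0 ?invr_gt0 ?root_gt0 // pmulr_rle0.
Qed.

Lemma euler_flip t : euler (rho b) (rho t) = 0 -> euler (rho b) (r t) = 0.
Proof. by rewrite /flip; case: ifP => _ E; rewrite ?eulerNr E ?oppr0. Qed.

Lemma basis_split : exists τ1 τ2, τ = τ1 ++ b :: τ2.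
Proof. by case/splitPr: first_in_basis => τ1 τ2; exists τ1, τ2. Qed.

(** Letters after [b] are covered by [fact_euler]. For [t] before [b] the value is the scalar
    product, whose sign is bounded on one side by [basis_obtuse] and on the other by [nc2_ascent] or
    [nc2_descent], according to whether [t] is flipped. *)
Lemma euler_first t : t \in τ -> t != b -> euler (rho b) (rho t) = 0.
Proof.
move=> tτ tb; have ft := basis_fact; have [τ1 [τ2 τE]] := basis_split.
have tB : t \in B by rewrite inE.
have := basis_obtuse tB tb; have := fact_euler ft.
rewrite τE in tτ ft *; rewrite pairwise_cat allrel_consr /= => /and3P[/andP[a1 _] _ /andP[a2 _]].
move: tτ; rewrite mem_cat inE (negPf tb) /= => /orP[t1|t2]; last first.
  by move=> _; apply/eqP; apply: (allP a2).
have f2 : fact [:: t; b].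
  apply: fact_subseq ft; rewrite -[[:: t; b]]/([:: t] ++ [:: b]).
  by apply: cat_subseq; rewrite sub1seq ?mem_head.
have Etb := fact2_euler f2.
have Ebt : euler (rho b) (rho t) = dotv (rho t) (rho b).
  by rewrite -euler_sym Etb add0r.
rewrite Ebt /flip inE => H; apply/eqP; rewrite eq_le; move: H; case: ifP => tA.
  by rewrite dotvNl oppr_le0 => ->; rewrite (nc2_ascent f2).
move=> ->; rewrite (nc2_descent f2) // notin_prec // inE tA //.
Qed.

Lemma euler_first_sum (a : refl -> R) :
  euler (rho b) (\sum_(u in B) a u *: r u) = a b * euler (rho b) (rho b).
Proof.
rewrite euler_sumr (bigD1 b) //= eulerZr flip_first big1 ?addr0 // => u /andP[uB ub].
by rewrite eulerZr euler_flip ?mulr0 // euler_first //; rewrite inE in uB.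
Qed.

Lemma euler_first_ge0 u : 0 <= euler (rho b) (r u).
Proof.
have [a a0 ->] := basis_cone u; rewrite euler_first_sum mulr_ge0 // ltW //.
exact: euler_gt0.
Qed.

(** Pairing [rho b] with the reflection of [r u] in [b] gives [- euler (r u) (rho b)], and that
    reflection is a positive multiple of a root of the system. *)
Lemma euler_first_le0 u : u != b -> euler (r u) (rho b) <= 0.
Proof.
move=> ub; have [x x0] := cone_act_simple r_root basis_indep basis_cone bB ub.
rewrite (act_refl _ _ r_root) flip_first => /(congr1 (euler (rho b))).
rewrite eulerDr eulerNr !eulerZr euler_self -euler_sym.
have -> : 2 * (euler (r u) (rho b) + euler (rho b) (r u)) / dotv (rho b) (rho b)
    * (dotv (rho b) (rho b) / 2) = euler (r u) (rho b) + euler (rho b) (r u).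
  by field; rewrite gt_eqF ?root_gt0.
have := mulr_ge0 (ltW x0) (euler_first_ge0 (conjr u (val b))); lra.
Qed.

(** Both Euler values of [b] with a letter of [τ1] vanish, so [b] commutes with [τ1] and can be
    brought to the front of c. Conjugating the other letters then carries it to the end. *)
Lemma flip_next : exists τ', flip_basis (b |: A)%SET τ'.
Proof.
have [τ1 [τ2 τE]] := basis_split; have [sz cτ _] := Aτ.
have ft := basis_fact; have ut := fact_uniq ft.
pose σ := τ1 ++ τ2; exists (rcons [seq conjr t (val b) | t <- σ] b).
have bσ : b \notin σ.
  by move: ut; rewrite τE -cat1s uniq_catCA cat1s /= => /andP[].
have τm t : (t \in τ) = (t == b) || (t \in σ).
  by rewrite τE !mem_cat inE orbCA.
split.
- by apply: etrans sz; rewrite size_rcons size_map τE !size_cat /= addnS.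
- rewrite -cats1 refl_prod_cat refl_prod_conj refl_prod_cons refl_prod_nil mulg1.
  rewrite conjgE val_inv -!mulgA val_sqr mulg1 cτ τE /σ !refl_prod_cat refl_prod_cons.
  rewrite !mulgA; congr (_ * _)%g.
  have : {in τ1, forall t, dotv (rho t) (rho b) = 0}.
    move=> t t1; have tσ : t \in σ by rewrite mem_cat t1.
    have tb : t != b by apply: contraNneq bσ => <-.
    have tt : t \in τ by rewrite τm tσ orbT.
    have f2 : fact [:: t; b].
      apply: fact_subseq ft; rewrite τE -[[:: t; b]]/([:: t] ++ [:: b]).
      by apply: cat_subseq; rewrite sub1seq ?mem_head.
    by rewrite -euler_sym (fact2_euler f2) (euler_first tt tb) addr0.
  elim: τ1 {τE σ bσ τm} => [|t σ IH] H; first by rewrite refl_prod_nil mulg1 mul1g.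
  rewrite refl_prod_cons -mulgA IH; last by move=> u us; apply: H; rewrite inE us orbT.
  by rewrite !mulgA (orthogonal_commute rho_root (H t (mem_head _ _))).
set τ' := rcons _ _; move=> t.
have fE u : u != b -> flip (b |: A)%SET u = r u.
  by move=> ub; rewrite /flip in_setU1 (negPf ub).
have fb : flip (b |: A)%SET b = - rho b by rewrite /flip setU11.
have [->|tb] := eqVneq t b.
  by apply: cone_root; rewrite inE mem_rcons mem_head.
rewrite fE //; have [x x0 xE] := cone_act_simple r_root basis_indep basis_cone bB tb.
(* Reflecting in [b], expanding in [τ] and reflecting back sends the basis root of [b] to [- rho b]
   and the others to positive multiples of their conjugates. *)
have -> : r t = x *: (r (conjr t (val b)) *m rG (val b)).
  by rewrite scalemxAl -xE -act_mul val_sqr repr_mx1 mulmx1.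
apply: coneZ; first exact: ltW.
have [a a0 ->] := basis_cone (conjr t (val b)).
rewrite mulmx_suml; apply: cone_sum => q; rewrite inE => qτ.
rewrite -scalemxAl; apply: coneZ => //.
have [->|qb] := eqVneq q b.
  rewrite flip_first (act_refl_self _ rho_root) -fb.
  by apply: cone_root; rewrite inE mem_rcons mem_head.
have [y y0 ->] := cone_act_simple r_root basis_indep basis_cone bB qb.
apply: coneZ; first exact: ltW.
rewrite -fE ?conjr_neq //; apply: cone_root.
rewrite inE mem_rcons in_cons; apply/orP; right; apply/mapP; exists q => //.
by move: qτ; rewrite τm (negPf qb).
Qed.

End FlipStep.

Lemma flip_basis_ex b : exists τ, flip_basis [set t | prec t b]%SET τ.
Proof.
have [m] := ubnP #|[set t | prec t b]%SET|; elim: m b => // m IHm b; rewrite ltnS => bm.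
have [A0|[t0]] := set_0Vmem [set t | prec t b]%SET.
  exists s; rewrite A0; split; rewrite ?size_tuple // => t.
  have [a a0 aE] := simple_cone t; exists a => //.
  by rewrite /flip inE aE; apply: eq_bigr => u _; rewrite inE.
rewrite inE => t0b.
have [b' b'b b'max] := @prec_max (fun t => prec t b) t0 t0b.
have [τ Aτ] : exists τ, flip_basis [set t | prec t b']%SET τ.
  by apply: IHm; apply: leq_trans bm; apply: rank_lt.
have [τ' Aτ'] := flip_next Aτ; exists τ'.
suff -> : [set t | prec t b]%SET = (b' |: [set t | prec t b'])%SET by [].
apply/setP => u; rewrite !inE; have [->//|ub'] := eqVneq u b'; rewrite /=.
apply/idP/idP => [ub|/prec_trans]; last exact.
case/orP: (prec_total ub') => // b'u.
by have := b'max u ub; rewrite b'u.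
Qed.

Lemma prec_euler t u : prec t u ->
  0 <= euler (rho t) (rho u) /\ euler (rho u) (rho t) <= 0.
Proof.
move=> tu; have [τ Aτ] := flip_basis_ex t.
have uE : flip [set x | prec x t]%SET u = rho u.
  by rewrite /flip inE (negPf (prec_asym tu)).
rewrite -uE; split; first exact: (euler_first_ge0 Aτ).
by apply: (euler_first_le0 Aτ); rewrite eq_sym prec_neq.
Qed.

(** * Decreasing factorizations and cones *)

(** The trace of a decreasing factorization that uniqueness needs. It passes to subsets, hence to
    the faces of the cones. *)
Definition clique (A : {set refl}) :=
  {in A &, forall t u, prec u t -> euler (rho t) (rho u) = 0}.

Lemma cliqueS (A B : {set refl}) : A \subset B -> clique B -> clique A.
Proof. by move=> /fintype.subsetP AB cB t u /AB tB /AB; apply: cB. Qed.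

Section UniqueCoordinates.
Variables a b : refl -> R.
Hypothesis b_ge0 : forall t, 0 <= b t.
Hypothesis ab : \sum_t a t *: rho t = \sum_t b t *: rho t.
Hypothesis clique_a : forall t u, a t != 0 -> a u != 0 -> prec u t ->
  euler (rho t) (rho u) = 0.

(** Apply [euler (rho t)] to the difference. Later terms cancel; at an earlier [u] the part of [a]
    vanishes and that of [b] has a known sign by [prec_euler]. Exchanging [a] and [b] gives the
    other inequality. *)
Lemma clique_coord_le t : (forall u, prec t u -> a u = b u) -> a t <= b t.
Proof.
move=> H; have [->//|at0] := eqVneq (a t) 0.
have : 0 = \sum_u (a u - b u) * euler (rho t) (rho u).
  transitivity (euler (rho t) (\sum_u a u *: rho u - \sum_u b u *: rho u)).
    by rewrite ab subrr -(scale0r (0 : 'rV_n)) eulerZr mul0r.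
  rewrite -sumrB euler_sumr; apply: eq_bigr => u _.
  by rewrite -scalerBl eulerZr.
rewrite (bigD1 t) //= => E; rewrite -subr_le0 -(pmulr_lle0 _ (euler_gt0 t)).
rewrite -(lerD2r (\sum_(u | u != t) (a u - b u) * euler (rho t) (rho u))) -E add0r.
apply: sumr_ge0 => u ut; case/orP: (prec_total ut) => p; last first.
  by rewrite H // subrr mul0r.
have [_ Eut] := prec_euler p; rewrite mulrBl.
have -> : a u * euler (rho t) (rho u) = 0.
  have [->|au0] := eqVneq (a u) 0; first by rewrite mul0r.
  by rewrite clique_a ?mulr0.
by rewrite sub0r oppr_ge0 mulr_ge0_le0.
Qed.
End UniqueCoordinates.

Lemma unique_coord (a b : refl -> R) :
  (forall t, 0 <= a t) -> (forall t, 0 <= b t) ->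
  \sum_t a t *: rho t = \sum_t b t *: rho t ->
  (forall t u, a t != 0 -> a u != 0 -> prec u t -> euler (rho t) (rho u) = 0) ->
  (forall t u, b t != 0 -> b u != 0 -> prec u t -> euler (rho t) (rho u) = 0) ->
  a =1 b.
Proof.
move=> a0 b0 ab ca cb t0; apply/eqP; apply: contraT => ab0.
have [t abt tmax] := @prec_max (fun t => a t != b t) t0 ab0.
have H u : prec t u -> a u = b u.
  by move=> tu; apply/eqP; apply: contraTT tu; apply: tmax.
case/eqP: abt; apply/eqP; rewrite eq_le (clique_coord_le b0 ab ca H) /=.
by apply: (clique_coord_le a0 (esym ab) cb) => u /H.
Qed.

Lemma clique_coord (A B : {set refl}) (a b : refl -> R) : clique A -> clique B ->
  (forall t, 0 <= a t) -> (forall t, 0 <= b t) ->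
  \sum_(t in A) a t *: rho t = \sum_(t in B) b t *: rho t ->
  forall t, (if t \in A then a t else 0) = (if t \in B then b t else 0).
Proof.
move=> cA cB a0 b0 ab; apply: unique_coord.
- by move=> t; case: ifP.
- by move=> t; case: ifP.
- have E (C : {set refl}) (f : refl -> R) :
    \sum_t (if t \in C then f t else 0) *: rho t = \sum_(t in C) f t *: rho t.
    by rewrite [RHS]big_mkcond; apply: eq_bigr => t _; case: ifP; rewrite ?scale0r.
  by rewrite !E.
- by move=> t u; case: ifP => tA; case: ifP => uA; rewrite ?eqxx // => _ _; apply: cA.
- by move=> t u; case: ifP => tB; case: ifP => uB; rewrite ?eqxx // => _ _; apply: cB.
Qed.

(** The sum of the roots of [A] has all its coordinates at [A] equal to 1, so by uniqueness they
    occur in [B]. *)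
Lemma clique_sub (A B : {set refl}) : clique A -> clique B ->
  cone rho B (\sum_(t in A) rho t) -> A \subset B.
Proof.
move=> cA cB [b b0 E]; apply/fintype.subsetP => t tA.
have := @clique_coord A B (fun=> 1) b cA cB (fun=> ler01) b0 _ t; rewrite tA.
case: ifP => // _ H; have /eqP := H (etrans (eq_bigr _ (fun i _ => scale1r _)) E).
by rewrite oner_eq0.
Qed.

Lemma clique_sub_cone (A B : {set refl}) : clique A -> clique B ->
  subset (cone rho A) (cone rho B) -> A \subset B.
Proof.
move=> cA cB AB; apply: clique_sub => //; apply: AB.
by apply: cone_sum => t; apply: cone_root.
Qed.

Lemma clique_cap (A B : {set refl}) v : clique A -> clique B ->
  cone rho A v -> cone rho B v -> cone rho (A :&: B)%SET v.
Proof.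
move=> cA cB [a a0 ->] [b b0 E]; exists a => //.
rewrite (big_setID B) /= [X in _ + X]big1 ?addr0 // => t; rewrite inE => /andP[tB tA].
by have := clique_coord cA cB a0 b0 E t; rewrite tA (negPf tB) => ->; rewrite scale0r.
Qed.

(** * Rewriting ascents *)

Definition desc t u := prec u t.

Lemma desc_trans : transitive desc.
Proof. by move=> t u v ut tv; apply: prec_trans tv ut. Qed.

Lemma desc_clique τ : fact τ -> sorted desc τ -> clique [set t in τ]%SET.
Proof.
move=> /fact_euler pe; rewrite (sorted_pairwise desc_trans) => pd t u.
rewrite !inE => tτ uτ ut; rewrite -(nth_index t tτ) -(nth_index t uτ).
have si : (index t τ < size τ)%N by rewrite index_mem.
have sk : (index u τ < size τ)%N by rewrite index_mem.
have [ik|ki|e] := ltngtP (index t τ) (index u τ).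
- by apply/eqP; apply: (pairwiseP t pe); rewrite ?inE.
- have := pairwiseP t pd _ _ sk si ki; rewrite !nth_index // /desc => tu.
  by have := prec_asym tu; rewrite ut.
by move: ut; rewrite -(nth_index t tτ) -(nth_index t uτ) e prec_irr.
Qed.

(* Replacing an ascent [t, u] by [x, y] with [prec t x] makes a sequence larger *)
(* for the lexicographic order, hence makes [weight] smaller.                   *)
Fixpoint weight (τ : seq refl) : nat :=
  if τ is t :: τ' then ((#|{: refl}| - rank t) * #|{: refl}|.+1 ^ size τ' + weight τ')%N
  else 0.

(** The weight is a numeral in base [#|{: refl}|.+1], since its digits are at most [#|{: refl}|]. *)
Lemma weight_lt τ : (weight τ < #|{: refl}|.+1 ^ size τ)%N.
Proof.
elim: τ => [|t τ IH] //=; rewrite expnS mulSn -addnS [leqRHS]addnC.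
by apply: leq_add => //; rewrite leq_mul2r leq_subr orbT.
Qed.

Lemma weight_ltlex τ1 t x τ2 τ2' : prec t x -> size τ2 = size τ2' ->
  (weight (τ1 ++ x :: τ2') < weight (τ1 ++ t :: τ2))%N.
Proof.
move=> tx sz; elim: τ1 => [|y τ1 IH] /=.
  rewrite sz; apply: leq_trans (leq_addr _ _).
  apply: (@leq_trans ((#|{: refl}| - rank x).+1 * #|{: refl}|.+1 ^ size τ2')).
    by rewrite mulSn addnC -addSn leq_add2r weight_lt.
  rewrite leq_mul2r; apply/orP; right.
  have rx : (rank x <= #|{: refl}|)%N by apply: max_card.
  by have := rank_lt tx; move: rx; move: (rank _) (rank _) #|{: refl}| => p q m; lia.
by rewrite !size_cat /= sz ltn_add2l.
Qed.

Lemma ascent_ex τ : ~~ sorted desc τ ->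
  exists τ1 t u τ2, τ = τ1 ++ t :: u :: τ2 /\ ~~ desc t u.
Proof.
elim: τ => // t [|u τ] IH //=; rewrite negb_and => /orP[tu|/IH].
  by exists [::], t, u, τ.
by move=> [τ1 [x [y [τ2 [-> xy]]]]]; exists (t :: τ1), x, y, τ2.
Qed.

Lemma fact_infix2 τ1 t u τ2 : fact (τ1 ++ t :: u :: τ2) -> fact [:: t; u].
Proof.
apply: fact_subseq; rewrite -[[:: t; u]]cat0s; apply: cat_subseq (sub0seq _) _.
by rewrite /= !eqxx sub0seq.
Qed.

(** An ascent is replaced by several pairs at once, so the induction hypothesis covers every pair
    with the same product and a larger first letter. *)
Lemma fact_ind (Q : seq refl -> Prop) :
  (forall τ, fact τ -> sorted desc τ -> Q τ) ->
  (forall τ1 t u τ2, fact (τ1 ++ t :: u :: τ2) -> prec t u ->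
    (forall x y : refl, prec t x -> (val x * val y = val t * val u)%g ->
      Q (τ1 ++ x :: y :: τ2)) ->
    Q (τ1 ++ t :: u :: τ2)) ->
  forall τ, fact τ -> Q τ.
Proof.
move=> Q0 QS τ; have [m] := ubnP (weight τ); elim: m τ => // m IHm τ; rewrite ltnS => wm ft.
have [so|/ascent_ex[τ1 [t [u [τ2 [E tu]]]]]] := boolP (sorted desc τ); first exact: Q0.
rewrite {}E in ft wm *; have f2 := fact_infix2 ft.
have {}tu : prec t u by case/orP: (prec_total (fact2_neq f2)) => // ut; rewrite /desc ut in tu.
apply: QS => // x y tx xy; apply: IHm.
  by apply: leq_trans wm; apply: weight_ltlex.
apply: (@fact_replace τ1 [:: t; u] [:: x; y] τ2) => //.
by rewrite !refl_prod2 xy.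
Qed.

(** The area [D i] of the i-th root with the vector is [y] at the first root and [- x] at the last.
    The vector lies just before the first positive index where it is nonpositive. *)
Lemma plane_cover t u l X Y x y : plane_seq t u l X Y -> 0 <= x -> 0 <= y ->
  exists i p q, [/\ (i.+1 < size l)%N, 0 <= p, 0 <= q
    & x *: rho (nth t l 0) + y *: rho (nth t l (size l).-1)
        = p *: rho (nth t l i.+1) + q *: rho (nth t l i)].
Proof.
move=> H x0 y0; have s1 := pl_size H; have [X0 Y0 Xm Ym] := plane_seq_ends H.
pose D i := X (nth t l i) * y - Y (nth t l i) * x.
have exk : exists k, [&& (0 < k)%N, (k < size l)%N & D k <= 0].
  exists (size l).-1; rewrite ltn_predRL s1 ltn_predL (ltnW s1) /D Xm Ym mul0r mul1r.
  by rewrite sub0r oppr_le0.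
case: (ex_minnP exk) => -[//|i] /and3P[_ si Di] imin.
have Di' : 0 <= D i.
  case: i si Di imin => [|i] si Di imin; first by rewrite /D X0 Y0 mul0r mul1r subr0.
  rewrite leNgt; apply/negP => neg; have := imin i.+1.
  by rewrite (ltnW si) (ltW neg) => /(_ isT); rewrite ltnn.
have A := pl_area H (ltnSn i) si.
have [_ _ E1] := pl_coord H (mem_nth t si).
have [_ _ E2] := pl_coord H (mem_nth t (ltnW si)).
rewrite /D in Di Di'.
set P := nth t l i.+1 in A Di *; set Q := nth t l i in A Di' *.
(* Cramer's rule. *)
exists i, ((X Q * y - Y Q * x) / (X Q * Y P - Y Q * X P)),
  ((Y P * x - X P * y) / (X Q * Y P - Y Q * X P)); split=> //.
- by rewrite divr_ge0 // ltW.
- by apply: divr_ge0; [rewrite -oppr_le0 opprB|apply: ltW].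
rewrite -/P -/Q E1 E2; apply/rowP => m; rewrite !mxE; field.
by rewrite gt_eqF.
Qed.

Lemma cone_replace τ1 t u x y τ2 :
  cone rho [set z in τ1 ++ t :: u :: τ2]%SET (rho x) ->
  cone rho [set z in τ1 ++ t :: u :: τ2]%SET (rho y) ->
  subset (cone rho [set z in τ1 ++ x :: y :: τ2]%SET)
         (cone rho [set z in τ1 ++ t :: u :: τ2]%SET).
Proof.
move=> cx cy; apply: cone_trans => z; rewrite inE mem_cat !inE.
case/or4P=> [z1|/eqP->//|/eqP->//|z2]; apply: cone_root.
  by rewrite inE mem_cat z1.
by rewrite inE mem_cat !inE z2 !orbT.
Qed.

Definition refines (τ σ : seq refl) :=
  [/\ fact σ, sorted desc σ, size σ = size τ, refl_prod σ = refl_prod τ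
    & subset (cone rho [set t in σ]%SET) (cone rho [set t in τ]%SET)].

Lemma nc2_root_cone τ1 t u τ2 l X Y : plane_seq t u l X Y ->
  t = nth t l 0 -> u = nth t l (size l).-1 ->
  {in l, forall r, cone rho [set z in τ1 ++ t :: u :: τ2]%SET (rho r)}.
Proof.
move=> H tE uE r rl; have [X0 Y0 ->] := pl_coord H rl; rewrite -tE -uE.
by apply: coneD; apply: coneZ => //; apply: cone_root; rewrite inE mem_cat !inE eqxx ?orbT.
Qed.

Lemma ascent_cone τ1 t u τ2 l X Y v : fact (τ1 ++ t :: u :: τ2) ->
  plane_seq t u l X Y -> t = nth t l 0 -> u = nth t l (size l).-1 ->
  cone rho [set z in τ1 ++ t :: u :: τ2]%SET v ->
  exists2 i, (i.+1 < size l)%N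
    & cone rho [set z in τ1 ++ nth t l i.+1 :: nth t l i :: τ2]%SET v.
Proof.
move=> ft H tE uE [a a0 vE]; have ut := fact_uniq ft.
have [i [p [q [si p_ge0 q_ge0 pqE]]]] := plane_cover H (a0 t) (a0 u).
rewrite -tE -uE in pqE; exists i => //.
have sE : [set z in τ1 ++ t :: u :: τ2]%SET = (t |: (u |: [set z in τ1 ++ τ2]))%SET.
  by apply/setP => z; rewrite !inE !mem_cat !inE; do !bool_congr.
have [tN uN] : t \notin (u |: [set z in τ1 ++ τ2])%SET /\ u \notin [set z in τ1 ++ τ2]%SET.
  move: ut; rewrite -[t :: u :: τ2]/([:: t; u] ++ τ2) uniq_catCA /= => /andP[tN /andP[uN _]].
  by rewrite !inE in tN *; rewrite !mem_cat in tN uN *; split.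
rewrite vE sE !big_setU1 //= addrA pqE; apply: coneD; first apply: coneD.
- by apply: coneZ => //; apply: cone_root; rewrite inE mem_cat !inE eqxx orbT.
- by apply: coneZ => //; apply: cone_root; rewrite inE mem_cat !inE eqxx !orbT.
apply: cone_sum => z; rewrite inE mem_cat => zτ; apply: coneZ => //.
by apply: cone_root; rewrite inE mem_cat !inE; case/orP: zτ => ->; rewrite ?orbT.
Qed.

Lemma ascent_refines τ1 t u τ2 l X Y i σ : plane_seq t u l X Y ->
  t = nth t l 0 -> u = nth t l (size l).-1 -> (i.+1 < size l)%N ->
  (val (nth t l i.+1) * val (nth t l i) = val t * val u)%g ->
  refines (τ1 ++ nth t l i.+1 :: nth t l i :: τ2) σ -> refines (τ1 ++ t :: u :: τ2) σ.
Proof.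
move=> H tE uE si xy [fσ sσ zσ pσ cσ]; split=> //; first by rewrite zσ !size_cat.
  by rewrite pσ !(refl_prod_cat, refl_prod_cons) (mulgA (val (nth t l i.+1))) xy -(mulgA (val t)).
move=> w /cσ; apply: cone_replace; apply: (nc2_root_cone _ _ H) => //.
  exact: mem_nth.
by apply: mem_nth; apply: ltnW.
Qed.

Lemma cover τ : fact τ -> forall v, cone rho [set t in τ]%SET v ->
  exists2 σ, refines τ σ & cone rho [set t in σ]%SET v.
Proof.
elim/fact_ind => {τ} [τ ft so v cv|τ1 t u τ2 ft tu IH v cv].
  by exists τ => //; split.
have f2 := fact_infix2 ft; have [l [X [Y [H pS p0 _]]]] := nc2_seq f2.
have := nc2_nth f2 H pS p0; rewrite tu => -[tE uE].
have [i si cv'] := ascent_cone ft H tE uE cv.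
have px : prec t (nth t l i.+1).
  by rewrite [X in prec X]tE (pl_sortedP H) // ltnW // (pl_size H).
have [σ rσ vσ] := IH _ _ px (pS i si) v cv'; exists σ => //.
exact: (ascent_refines H tE uE si (pS i si)).
Qed.

(** * Decreasing factorizations as faces *)

Lemma set_seq_card (τ : seq refl) : uniq τ -> #|[set t in τ]%SET| = size τ.
Proof. by move=> ut; rewrite cardsE; apply/card_uniqP. Qed.

Lemma fact_of_c τ : size τ = n -> c = refl_prod τ -> fact τ.
Proof. by move=> sz cτ; apply/factP; exists [::]; rewrite cats0. Qed.

Lemma desc_dotv τ : fact τ -> sorted desc τ ->
  {in τ &, forall t u, t != u -> 0 <= dotv (rho t) (rho u)}.
Proof.
move=> ft; rewrite (sorted_pairwise desc_trans) => so t u tτ uτ tu.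
have H x y : subseq [:: x; y] τ -> 0 <= dotv (rho x) (rho y).
  by move=> xy; apply: nc2_descent; [apply: fact_subseq ft|apply: (subseq2_pairwise so)].
by case/orP: (pair_subseq tτ uτ tu) => /H //; rewrite dotvC.
Qed.

Lemma desc_facet τ : size τ = n -> c = refl_prod τ -> sorted desc τ ->
  is_facet rho c [set t in τ]%SET.
Proof.
move=> sz cτ so; have ft := fact_of_c sz cτ; have ut := fact_uniq ft.
move/eqP: sz => sz; exists (Tuple sz); split=> // i j ij.
apply: (desc_dotv ft so); rewrite ?(mem_tnth _ (Tuple sz)) //.
by apply: contra ij => /eqP /(tuple_uniqP (Tuple sz) ut) ->.
Qed.

(* Complete [τ] to a factorization of c: its cone is covered by the cones of     *)
(* facets, and the facet containing the sum of the roots of [τ] contains [τ].    *)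
Lemma desc_face τ : fact τ -> sorted desc τ -> is_face rho c [set t in τ]%SET.
Proof.
move=> ft so; have /factP[τ' [sz cτ]] := ft; have ft' := fact_of_c sz cτ.
have cv : cone rho [set t in τ ++ τ']%SET (\sum_(t in [set t in τ]%SET) rho t).
  apply: cone_sum => t; rewrite inE => tτ; apply: cone_root.
  by rewrite inE mem_cat tτ.
have [σ [fσ sσ zσ pσ _] vσ] := cover ft' cv.
exists [set t in σ]%SET.
  by apply: desc_facet => //; rewrite ?zσ ?pσ.
by apply: clique_sub vσ; apply: desc_clique.
Qed.

Lemma insert_commute (σ : seq refl) t : sorted desc σ -> t \notin σ ->
  {in σ, forall u, prec u t || ((val t * val u)%g == (val u * val t)%g)} ->
  exists2 σ', perm_eq σ' (t :: σ) & sorted desc σ' /\ refl_prod σ' = refl_prod (t :: σ).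
Proof.
elim: σ => [|u σ IH] so tσ H; first by exists [:: t].
have [ut|utN] := boolP (prec u t).
  by exists [:: t, u & σ]; rewrite //= /desc ut.
move: tσ; rewrite inE negb_or => /andP[tu tσ].
have ptu : prec t u by case/orP: (prec_total tu) => // ut; rewrite ut in utN.
have [|σ' pσ' [sσ' prσ']] := IH (path_sorted so) tσ.
  by move=> x xσ; apply: H; rewrite inE xσ orbT.
exists (u :: σ').
  apply: (@perm_trans _ [:: u, t & σ]); first by rewrite perm_cons.
  by apply/seq.permP => p /=; rewrite addnCA.
move: so; rewrite /= !(path_sortedE desc_trans) => /andP[au so]; split.
  rewrite sσ' andbT (perm_all _ pσ') /= au andbT; exact: ptu.
rewrite !refl_prod_cons prσ' refl_prod_cons !mulgA; congr (_ * _)%g.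
by have := H u (mem_head _ _); rewrite (negPf utN) => /eqP.
Qed.

(** Insertion sort into decreasing order exchanges only ascending pairs, and these commute. *)
Lemma sort_commute (τ : seq refl) : uniq τ ->
  pairwise (fun t u => prec u t || ((val t * val u)%g == (val u * val t)%g)) τ ->
  exists2 σ, perm_eq σ τ & sorted desc σ /\ refl_prod σ = refl_prod τ.
Proof.
elim: τ => [|t τ IH]; first by exists [::].
rewrite /= => /andP[tτ ut] /andP[/allP at_ /(IH ut)[σ pσ [sσ prσ]]].
have [||σ' pσ' [sσ' prσ']] := @insert_commute σ t sσ.
- by rewrite (perm_mem pσ).
- by move=> u; rewrite (perm_mem pσ) => /at_.
exists σ'; last by rewrite prσ' !refl_prod_cons prσ.
by apply: perm_trans pσ' _; rewrite perm_cons.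
Qed.

Lemma desc_perm_eq σ τ : sorted desc σ -> sorted desc τ -> σ =i τ -> σ = τ.
Proof.
move=> sσ sτ; apply: (irr_sorted_eq desc_trans) => // t.
exact: prec_irr.
Qed.

(** Whichever ordering [nc] picks, an ascending pair in it has one Euler value zero by [fact_euler]
    and the other by [clique]. The pair is orthogonal, and sorting recovers [τ]. *)
Lemma nc_desc τ : fact τ -> sorted desc τ -> nc c [set t in τ]%SET = refl_prod τ.
Proof.
move=> ft so; have ut := fact_uniq ft; have cl := desc_clique ft so.
rewrite /nc; case: pickP => [w /andP[ncw /existsP[σ /andP[/eqP sE /eqP pE]]]|]; last first.
  move=> /(_ (refl_prod τ)); rewrite set_seq_card // [NC _ _ _ _]ft /=.
  by move=> /existsP[]; exists (in_tuple τ); rewrite /= !eqxx.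
have fσ : fact σ by rewrite /fact size_tuple pE.
have sm : σ =i τ by move=> t; have := congr1 (fun A : {set refl} => t \in A) sE; rewrite !inE.
have [|σ' pσ' [sσ' prσ']] := @sort_commute σ (fact_uniq fσ); last first.
  rewrite /= -pE -prσ'; congr (refl_prod _); apply: desc_perm_eq => // t.
  by rewrite (perm_mem pσ') sm.
apply: pairwise_subseq2 => t u tu; have ftu := fact_subseq tu fσ.
have [//|utN] := boolP (prec u t); apply/eqP.
have ptu : prec t u by case/orP: (prec_total (fact2_neq ftu)) => // p; rewrite p in utN.
apply: (orthogonal_commute rho_root); rewrite -euler_sym (fact2_euler ftu) add0r.
by apply: cl => //; rewrite inE -sm; apply: (mem_subseq tu); rewrite !inE eqxx ?orbT.
Qed.

(** In a factorization defining a facet, an ascending pair has a nonpositive scalar product by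
    [nc2_ascent] and a nonnegative one by definition, so it commutes and can be sorted. *)
Lemma face_desc f : is_face rho c f ->
  exists τ, [/\ fact τ, sorted desc τ & f = [set t in τ]%SET].
Proof.
move=> [g [s' [gE cs' dots]] fg]; have fs := fact_of_c (size_tuple s') cs'.
have [|σ pσ [sσ prσ]] := @sort_commute s' (fact_uniq fs).
  apply: pairwise_subseq2 => t u tu; have ftu := fact_subseq tu fs.
  have [//|utN] := boolP (prec u t); apply/eqP.
  have ptu : prec t u by case/orP: (prec_total (fact2_neq ftu)) => // p; rewrite p in utN.
  apply: (orthogonal_commute rho_root); apply/eqP; rewrite eq_le nc2_ascent //=.
  have /tnthP[i ti] : t \in s' by apply: (mem_subseq tu); rewrite mem_head.
  have /tnthP[j uj] : u \in s' by apply: (mem_subseq tu); rewrite !inE eqxx orbT.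
  rewrite ti uj dots //; apply: contraTneq (fact2_neq ftu) => ij.
  by rewrite ti uj ij eqxx.
exists [seq t <- σ | t \in f]; have sub := filter_subseq (mem f) σ; split.
- apply: (fact_subseq sub); apply: fact_of_c; last by rewrite prσ.
  by rewrite (perm_size pσ) size_tuple.
- exact: subseq_sorted desc_trans _ _ sub sσ.
apply/setP => t; rewrite inE mem_filter (perm_mem pσ).
have [/(fintype.subsetP fg)|//] := boolP (t \in f).
by rewrite gE inE.
Qed.

(** Equality of products also fixes the size, as both factorizations are reduced. *)
Lemma XfacesP (ts : seq refl) f : fact ts ->
  f \in Xfaces rho c (in_tuple ts) <-> exists2 τ, refines ts τ & f = [set t in τ]%SET.
Proof.
move=> fts; rewrite inE; split=> [/asboolP[/face_desc[τ [ft so ->]]]|[τ [ft so sz pr sub] ->]].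
  rewrite nc_desc // => pr sub; exists τ; split=> //.
  by rewrite -(fact_length ft) -(fact_length fts) pr.
by apply/asboolP; split; [apply: desc_face|rewrite nc_desc|].
Qed.

(** * Subdivision at an ascent *)

Lemma row_root_mx (j : nat) (τ : seq refl) (i : 'I_j) :
  row i (root_mx rho j τ) = (map rho τ)`_i.
Proof. exact: rowK. Qed.

Lemma free_root_mx τ : free (map rho τ) -> row_free (root_mx rho (size τ) τ).
Proof.
move=> fr; apply: inj_row_free => v v0.
have /freeP H : free (map_tuple rho (in_tuple τ)) by [].
apply/rowP => i; rewrite mxE; apply: (H (fun i => v 0 i)).
by rewrite -[RHS]v0 mulmx_sum_row; apply: eq_bigr => m _; rewrite row_root_mx.
Qed.

Lemma root_mx_free τ : fact τ -> row_free (root_mx rho (size τ) τ).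
Proof. by move=> /fact_free; apply: free_root_mx. Qed.

Lemma root_sub_mx τ t : t \in τ -> (rho t <= root_mx rho (size τ) τ)%MS.
Proof.
move=> tτ; have si : (index t τ < size τ)%N by rewrite index_mem.
have <- : row (Ordinal si) (root_mx rho (size τ) τ) = rho t.
  by rewrite row_root_mx (nth_map t) //= nth_index.
exact: row_sub.
Qed.

Lemma cone_sub_mx τ v : cone rho [set t in τ]%SET v -> (v <= root_mx rho (size τ) τ)%MS.
Proof.
move=> [a _ ->]; apply: summx_sub => t; rewrite inE => tτ.
by rewrite scalemx_sub ?root_sub_mx.
Qed.

(** Independence lets pairings be prescribed freely; this produces the separating and supporting
    hyperplanes below. *)
Lemma dual_vector τ (b : refl -> R) : fact τ ->
  exists v, {in τ, forall t, dotv v (rho t) = b t}.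
Proof.
move=> ft; have fr := root_mx_free ft; have ut := fact_uniq ft.
pose M := root_mx rho (size τ) τ.
case: τ ft fr ut @M => [|t0 τ0]; first by exists 0.
set τ := t0 :: τ0 => ft fr ut M.
pose v := (pinvmx M *m (\col_i b (nth t0 τ i)))^T.
exists v => t tτ; have si : (index t τ < size τ)%N by rewrite index_mem.
have tE : row (Ordinal si) M = rho t.
  by rewrite row_root_mx (nth_map t0) //= nth_index.
rewrite dotvC /dotv trmxK -tE -row_mul mulmxA mulmxVp // mul1mx !mxE /=.
by rewrite nth_index.
Qed.

(** Determinants multiply. Freeness of [us] excludes determinant 0, so that not being positively
    oriented means a negative determinant. *)
Lemma orient_flip j (ts ts' us : seq refl) (G : 'M[R]_j) :
  root_mx rho j ts' = G *m root_mx rho j ts -> \det G < 0 ->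
  row_free (root_mx rho j ts) -> row_free (root_mx rho j us) ->
  (root_mx rho j us <= root_mx rho j ts')%MS ->
  pos_oriented rho j ts us <-> ~ pos_oriented rho j ts' us.
Proof.
move=> GE G0 fts fus /submxP[Q QE].
have Qu : \det Q != 0.
  rewrite -unitfE -unitmxE -row_free_unit -row_leq_rank.
  by apply: leq_trans (mxrankM_maxl Q (root_mx rho j ts')); rewrite -QE row_leq_rank.
have QG : root_mx rho j us = (Q *m G) *m root_mx rho j ts by rewrite QE GE mulmxA.
split=> [[Q1 E1 d1] [Q2 E2 d2]|npos].
  have : Q1 = Q2 *m G.
    by apply: (row_free_inj fts); rewrite -E1 -mulmxA -GE.
  move=> E; move: d1; rewrite E det_mulmx => /lt_gtF.
  by rewrite pmulr_rlt0 // G0.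
exists (Q *m G) => //; rewrite det_mulmx nmulr_lgt0 // lt_neqAle Qu /= leNgt.
by apply/negP => d; apply: npos; exists Q.
Qed.

Section Ascent.
Variables (τ1 : seq refl) (t u : refl) (τ2 l : seq refl) (X Y : refl -> R).
Local Notation ts := (τ1 ++ t :: u :: τ2).
Local Notation tsi i := (τ1 ++ nth t l i.+1 :: nth t l i :: τ2).
Hypothesis fts : fact ts.
Hypothesis H : plane_seq t u l X Y.
Hypothesis tE : t = nth t l 0.
Hypothesis uE : u = nth t l (size l).-1.
Hypothesis pS : forall i, (i.+1 < size l)%N ->
  (val (nth t l i.+1) * val (nth t l i) = val t * val u)%g.

Lemma ascent_fact i : (i.+1 < size l)%N -> fact (tsi i).
Proof.
move=> si; apply: (@fact_replace τ1 [:: t; u] [:: _; _] τ2) => //.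
by rewrite !refl_prod2 pS.
Qed.

(** The sum of the roots of [σ] lies in one piece of the subdivision, hence in the cone of a
    refinement [σ'] of it. By [clique_sub] this contains [σ], and the sizes agree. *)
Lemma refines_ascent σ : refines ts σ ->
  exists2 i, (i.+1 < size l)%N & refines (tsi i) σ.
Proof.
move=> rσ; have [fσ sσ zσ pσ cσ] := rσ.
have cv : cone rho [set z in σ]%SET (\sum_(z in [set z in σ]%SET) rho z).
  by apply: cone_sum => z; apply: cone_root.
have [i si cv'] := ascent_cone fts H tE uE (cσ _ cv).
have [σ' rσ' vσ'] := cover (ascent_fact si) cv'.
exists i => //; have [fσ' sσ' zσ' pσ' cσ'] := rσ'.
suff -> : σ = σ' by [].
have sub : [set z in σ]%SET \subset [set z in σ']%SET.
  by apply: clique_sub vσ'; apply: desc_clique.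
have /setP E : [set z in σ]%SET = [set z in σ']%SET.
  apply/eqP; rewrite eqEcard sub !set_seq_card ?fact_uniq //.
  by rewrite zσ zσ' !size_cat /= leqnn.
by apply: desc_perm_eq => // z; have := E z; rewrite !inE.
Qed.

Lemma ends_notin z : z \in τ1 ++ τ2 -> z != t /\ z != u.
Proof.
have := fact_uniq fts.
rewrite -[t :: u :: τ2]/([:: t; u] ++ τ2) uniq_catCA /= => /andP[tN /andP[uN _]] zτ.
split; apply/eqP => E; rewrite -{}E in tN uN.
  by move: tN; rewrite inE zτ orbT.
by rewrite zτ in uN.
Qed.

(** The hyperplane through [l_(i+1)] and the roots of [τ1] and [τ2] separates the two pieces, so [σ]
    would lie in it. But [σ] spans the same space as [ts], and [rho t] is off the hyperplane. *)
Lemma refines_disjoint i k σ : (i < k)%N -> (k.+1 < size l)%N ->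
  refines (tsi i) σ -> refines (tsi k) σ -> False.
Proof.
move=> ik sk ri rk; have si : (i.+1 < size l)%N by apply: ltn_trans sk.
have [fσ _ zσ _ ci] := ri; have [_ _ _ _ ck] := rk.
have tu : t != u := fact2_neq (fact_infix2 fts).
pose p := nth t l i.+1; have [X0 Y0 _ _] := plane_seq_ends H.
have Yp : 0 < Y p.
  by have := pl_area H (ltn0Sn i) si; rewrite X0 Y0 mul1r mul0r subr0.
have [v vE] := dual_vector (fun z => if z == t then - Y p else if z == u then X p else 0) fts.
have vt : dotv v (rho t) = - Y p.
  by rewrite vE ?eqxx // mem_cat !inE eqxx orbT.
have vu : dotv v (rho u) = X p.
  by rewrite vE ?eqxx 1?eq_sym ?(negPf tu) // mem_cat !inE eqxx !orbT.
have vl z : z \in l -> dotv v (rho z) = X p * Y z - Y p * X z.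
  move=> zl; have [_ _ ->] := pl_coord H zl; rewrite -tE -uE dotvDr !dotvZr vt vu.
  by ring.
have v0 z : z \in τ1 ++ τ2 -> dotv v (rho z) = 0.
  move=> zτ; have [zt zu] := ends_notin zτ; rewrite vE ?(negPf zt) ?(negPf zu) //.
  by move: zτ; rewrite !mem_cat !inE => /orP[]->; rewrite ?orbT.
have memi m z : z \in tsi m -> [\/ z \in τ1 ++ τ2, z = nth t l m.+1 | z = nth t l m].
  rewrite !mem_cat !inE => /or4P[->|/eqP->|/eqP->|->]; rewrite ?orbT;
  by [constructor 1|constructor 2|constructor 3].
have vσ z : z \in σ -> dotv v (rho z) = 0.
  move=> zσ'; have cz : cone rho [set z in σ]%SET (rho z) by apply: cone_root; rewrite inE.
  apply/eqP; rewrite eq_le; apply/andP; split.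
    have [a a0 ->] := ci _ cz; rewrite dotv_sumr sumr_le0 // => w; rewrite inE => /memi wi.
    rewrite dotvZr mulr_ge0_le0 //; case: wi => [/v0->//|->|->].
      by rewrite vl ?mem_nth // -/p mulrC subrr.
    rewrite vl ?mem_nth ?(ltnW si) // -/p -oppr_ge0 opprB mulrC [X p * _]mulrC.
    by rewrite subr_ge0; have := pl_area H (ltnSn i) si; rewrite subr_gt0 -/p; apply: ltW.
  have [a a0 ->] := ck _ cz; rewrite dotv_sumr sumr_ge0 // => w; rewrite inE => /memi wk.
  rewrite dotvZr mulr_ge0 //.
  have area_ge m : (i.+1 <= m)%N -> (m < size l)%N -> 0 <= dotv v (rho (nth t l m)).
    rewrite leq_eqVlt => /predU1P[<-|im] sm; rewrite vl ?mem_nth // -/p.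
      by rewrite mulrC subrr.
    exact/ltW/(pl_area H im sm).
  by case: wk => [/v0->//|->|->]; apply: area_ge => //; [apply: leqW|apply: ltnW].
have [w wE] : exists w : 'rV_(size σ), rho t = w *m root_mx rho (size σ) σ.
  apply/submxP; have tsub : (rho t <= root_mx rho (size ts) ts)%MS.
    by apply: root_sub_mx; rewrite mem_cat !inE eqxx orbT.
  apply: submx_trans tsub _.
  have sub : (root_mx rho (size σ) σ <= root_mx rho (size ts) ts)%MS.
    apply/row_subP => m; rewrite row_root_mx (nth_map t) //; apply: cone_sub_mx.
    have [_ _ _ _ c'] := ascent_refines H tE uE si (pS si) ri; apply: c'.
    by apply: cone_root; rewrite inE mem_nth.
  rewrite -(mxrank_leqif_sup sub).
  have /eqP-> := root_mx_free fσ; have /eqP-> := root_mx_free fts.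
  by rewrite zσ !size_cat.
have : dotv v (rho t) = 0.
  rewrite wE mulmx_sum_row dotv_sumr big1 // => m _.
  by rewrite dotvZr row_root_mx (nth_map t) // vσ ?mulr0 // mem_nth.
by rewrite vt => /eqP; rewrite oppr_eq0 gt_eqF.
Qed.

(** The base change [G] alters only the two rows of the ascent; its determinant is the area of
    [l_(i+1), l_i], negative because they are listed in descending order. *)
Lemma ascent_omega i σ : (i.+1 < size l)%N -> refines (tsi i) σ ->
  pos_oriented rho (size ts) ts σ <-> ~ pos_oriented rho (size ts) (tsi i) σ.
Proof.
move=> si ri; have [fσ _ zσ _ ci] := ri.
have sz : size (tsi i) = size ts by rewrite !size_cat.
have sp : (size τ1 < size ts)%N by rewrite size_cat /= -addSnnS leq_addr.
have sq : ((size τ1).+1 < size ts)%N by rewrite size_cat /= -!addSnnS leq_addr.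
pose p := Ordinal sp; pose q := Ordinal sq.
have pq : p != q by rewrite -val_eqE /= ltn_eqF.
pose x := nth t l i.+1; pose y := nth t l i.
pose G := rows2 1%:M p q (X x *: row p 1%:M + Y x *: row q 1%:M)
                         (X y *: row p 1%:M + Y y *: row q 1%:M).
have [_ _ xE] := pl_coord H (mem_nth t si); rewrite -/x -tE -uE in xE.
have [_ _ yE] := pl_coord H (mem_nth t (ltnW si)); rewrite -/y -tE -uE in yE.
apply: (@orient_flip _ _ _ _ G).
- apply/row_matrixP => m; rewrite [LHS]row_root_mx [RHS]row_mul rowK map_cat nth_cat size_map /=.
  have rp : row p (1%:M : 'M[R]_(size ts)) *m root_mx rho (size ts) ts = rho t.
    by rewrite -row_mul mul1mx row_root_mx map_cat nth_cat size_map ltnn subnn.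
  have rq : row q (1%:M : 'M[R]_(size ts)) *m root_mx rho (size ts) ts = rho u.
    rewrite -row_mul mul1mx row_root_mx map_cat nth_cat size_map /= ltnNge leqnSn /=.
    by rewrite subSnn.
  have [mp|mp] := eqVneq m p.
    by rewrite mp /= ltnn subnn /= mulmxDl -!scalemxAl rp rq.
  have [mq|mq] := eqVneq m q.
    rewrite mq /= ltnNge leqnSn /= subSnn /=.
    by rewrite mulmxDl -!scalemxAl rp rq.
  rewrite -row_mul mul1mx row_root_mx map_cat nth_cat size_map; case: ltnP => // le.
  rewrite -!val_eqE /= in mp mq.
  case E : (m - size τ1)%N => [|[|m']] //.
    by move: mp; rewrite eqn_leq le andbT -subn_eq0 E.
  by move: mq; rewrite -(subnK le) E addSn add0n eqxx.
- rewrite /G det_rows2 //.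
  have -> : rows2 1%:M p q (row p 1%:M) (row q 1%:M) = 1%:M :> 'M[R]_(size ts).
    apply/row_matrixP => m; rewrite rowK; case: eqP => [->//|_].
    by case: eqP => [->|].
  rewrite det1 mulr1 subr_lt0 [Y x * _]mulrC [X x * _]mulrC.
  by have := pl_area H (ltnSn i) si; rewrite subr_gt0 -/x -/y.
- exact: root_mx_free.
- by have := root_mx_free fσ; rewrite zσ sz.
apply/row_subP => m; rewrite row_root_mx (nth_map t); last by rewrite zσ sz.
have cm : cone rho [set z in tsi i]%SET (rho (nth t σ m)).
  by apply: ci; apply: cone_root; rewrite inE mem_nth // zσ sz.
by have := cone_sub_mx cm; rewrite sz.
Qed.

End Ascent.

Lemma decr_seq_desc τ : sorted desc τ -> decr_seq prec [set t in τ]%SET = τ.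
Proof.
move=> so; rewrite /decr_seq.
pose le t u := (t == u) || prec u t.
have le_tr : transitive le.
  move=> x y z /predU1P[->//|xy] /predU1P[<-|yz]; first by rewrite /le xy orbT.
  by rewrite /le (prec_trans yz xy) orbT.
have le_anti : antisymmetric le.
  move=> x y /andP[/predU1P[//|yx] /predU1P[//|xy]].
  by have := prec_asym xy; rewrite yx.
have le_tot : total le.
  move=> x y; rewrite /le eq_sym; case: eqVneq => //= yx.
  exact: prec_total.
apply: (sorted_eq le_tr le_anti); first exact: sort_sorted.
  by apply: sub_sorted so => x y xy; apply/orP; right.
rewrite perm_sort; apply: uniq_perm; rewrite ?enum_uniq //.
  by apply: (sorted_uniq desc_trans) so => x; apply: prec_irr.
by move=> x; rewrite mem_enum inE.
Qed.

(** * Expansion in the dual algebra *)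

Variable k : fieldType.
Local Open Scope quotient_scope.
Local Notation rels := (monoid_rels k (dual_braid_rel (rG := rG) c)).

(** Both sides of a dual braid relation have the same product in W, so the indicator function of the
    pairs with product [w] is orthogonal to all relations. *)
Lemma x_gen_rel (w : gT) :
  \sum_(p : refl * refl | (val p.1 * val p.2)%g == w)
    x_gen k c p.1 * x_gen k c p.2 = 0.
Proof.
pose f : {ffun refl * refl -> k} := [ffun p => ((val p.1 * val p.2)%g == w)%:R].
have fo : quad_orth rels f.
  move=> _ [p [q [/and3P[_ /eqP q1 /eqP q2] ->]]].
  have E : (val q.1 * val q.2 = val p.1 * val p.2)%g.
    by rewrite q1 q2 !mulgA val_sqr mul1g.
  under eq_bigr do rewrite [X in _ * X]ffunE mulrBr.
  have D (z : refl * refl) : \sum_x f x * (x == z)%:R = f z.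
    rewrite (bigD1 z) //= eqxx mulr1 big1 ?addr0 // => x /negPf->.
    by rewrite mulr0.
  by rewrite sumrB !D !ffunE E subrr.
have: \pi_(ring_quot (@quad_elt k _ @` quad_orth rels)%classic) (quad_elt f) = 0.
  rewrite -[RHS](raddf0 (\pi_(ring_quot (@quad_elt k _ @` quad_orth rels)%classic))).
  apply/eqP; rewrite -Quotient.idealrBE subr0; apply/asboolP => J SJ _.
  by apply: SJ; exists f.
rewrite /quad_elt raddf_sum => fE; rewrite -[RHS]fE big_mkcond.
apply: eq_bigr => p _; rewrite ffunE; case: ifP => _.
  by rewrite scale1r; apply/esym; apply: pi_ring_quot_mul.
by rewrite scale0r raddf0.
Qed.

Lemma x_gen_ascent t u l X Y : fact [:: t; u] -> plane_seq t u l X Y ->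
  t = nth t l 0 -> u = nth t l (size l).-1 ->
  (forall i, (i.+1 < size l)%N ->
    (val (nth t l i.+1) * val (nth t l i) = val t * val u)%g) ->
  (forall x y : refl, (val x * val y = val t * val u)%g -> x \in l) ->
  x_gen k c t * x_gen k c u
    = - \sum_(i < (size l).-1) x_gen k c (nth t l i.+1) * x_gen k c (nth t l i).
Proof.
move=> f H tE uE pS pl; have s1 := pl_size H; have ul := pl_uniq H.
(* All factorizations of [t u] into two reflections; their first letters are precisely [l], so there
   is no repetition. *)
pose L := (t, u) :: [seq (nth t l i.+1, nth t l i) | i <- iota 0 (size l).-1].
have LP p : (p \in L) = ((val p.1 * val p.2)%g == (val t * val u)%g).
  apply/idP/eqP => [|E].
    rewrite inE => /predU1P[->//|/mapP[i]]; rewrite mem_iota add0n ltn_predRL => si ->.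
    exact: pS.
  have p1 := pl _ _ E; case: p E p1 => x y /= E xl.
  have : (index x l < size l)%N by rewrite index_mem.
  move: (nth_index t xl); case: (index x l) => [|i] xE si.
    have xt : x = t by rewrite -xE -tE.
    by rewrite xt in E *; rewrite (val_inj (mulgI _ _ _ E)) mem_head.
  have -> : y = nth t l i.
    by apply: val_inj; apply: (mulgI (val x)); rewrite E -(pS i si) xE.
  rewrite inE -{1 2}xE; apply/orP; right; apply/mapP; exists i => //.
  by rewrite mem_iota add0n ltn_predRL.
have uL : uniq L.
  apply: (map_uniq (f := fst)); suff -> : map fst L = l by [].
  rewrite /= -map_comp; case: l s1 tE {H uE pS pl ul L LP} => // a l' _ /= <-.
  by congr (_ :: _); apply: (mkseq_nth t l').
have := x_gen_rel (val t * val u)%g.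
rewrite (eq_bigl (mem L)); last by move=> p; rewrite -LP.
rewrite -big_uniq //= big_cons big_map /= => /eqP; rewrite addr_eq0 => /eqP->.
by congr (- _); rewrite -{1}[(size l).-1]subn0 big_mkord.
Qed.

Lemma x_prod_expansion τ : fact τ ->
  \prod_(t <- τ) x_gen k c t
    = \sum_(f in Xfaces rho c (in_tuple τ))
        x_face k c prec f *~ omega rho prec (in_tuple τ) f.
Proof.
elim/fact_ind => {τ} [τ ft so|τ1 t u τ2 ft tu IH].
  have cl := desc_clique ft so.
  have Xτ f : (f \in Xfaces rho c (in_tuple τ)) = (f == [set t in τ]%SET).
    apply/idP/eqP => [/(XfacesP _ ft)[σ [fσ sσ zσ pσ cσ] ->]|->]; last first.
      by apply/(XfacesP _ ft); exists τ => //; split.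
    apply/eqP; rewrite eqEcard !set_seq_card ?fact_uniq // zσ leqnn andbT.
    by apply: clique_sub_cone => //; apply: desc_clique.
  rewrite (big_pred1 [set t in τ]%SET) // /x_face decr_seq_desc //.
  suff -> : omega rho prec (in_tuple τ) [set t in τ]%SET = 1 by rewrite mulr1z.
  rewrite /omega decr_seq_desc //; case: asboolP => // -[].
  by exists 1%:M; rewrite ?mul1mx // det1.
have f2 := fact_infix2 ft; have [l [X [Y [H pS p0 pl]]]] := nc2_seq f2.
have := nc2_nth f2 H pS p0; rewrite tu => -[tE uE].
pose ts := τ1 ++ t :: u :: τ2.
pose tsi i := τ1 ++ nth t l i.+1 :: nth t l i :: τ2.
have si (i : 'I_(size l).-1) : (i.+1 < size l)%N by rewrite -ltn_predRL.
have fi (i : 'I_(size l).-1) : fact (tsi i) := ascent_fact ft pS (si i).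
have prodE : \prod_(z <- ts) x_gen k c z
    = - \sum_(i < (size l).-1) \prod_(z <- tsi i) x_gen k c z.
  rewrite big_cat !big_cons /= (mulrA (x_gen k c t)) (x_gen_ascent f2 H tE uE pS pl).
  rewrite mulNr mulrN mulr_suml mulr_sumr; congr (- _); apply: eq_bigr => i _.
  by rewrite big_cat !big_cons /= !mulrA.
rewrite {}prodE.
(* By [ascent_omega], the sign relative to [tsi i] is opposite to that relative to [ts], which
   prepares the cancellation of the minus sign in front. *)
have -> : \sum_(i < (size l).-1) \prod_(z <- tsi i) x_gen k c z
    = \sum_(i < (size l).-1) \sum_(f in Xfaces rho c (in_tuple (tsi i)))
        - (x_face k c prec f *~ omega rho prec (in_tuple ts) f).
  apply: eq_bigr => i _; rewrite IH; last first.
  - exact: pS.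
  - by rewrite [X in prec X]tE (pl_sortedP H) // ltnW // (pl_size H).
  apply: eq_bigr => f /(XfacesP _ (fi i))[σ rσ ->].
  rewrite -mulrNz; congr (_ *~ _); have [fσ sσ zσ _ _] := rσ.
  have := ascent_omega ft H tE uE (si i) rσ.
  rewrite /omega decr_seq_desc // !in_tupleE.
  have -> : size (tsi i) = size ts by rewrite !size_cat.
  by case: asboolP => A1; case: asboolP => A2 // [B1 B2];
    [case: (B1 A2 A1)|case: (A2 (B2 A1))].
(* Each face for [ts] belongs to exactly one [tsi i], by [refines_ascent] and [refines_disjoint], so
   the inner sum has a single term. *)
rewrite (exchange_big_dep (mem (Xfaces rho c (in_tuple ts)))) /=; last first.
  move=> i f _ /(XfacesP _ (fi i))[σ rσ ->]; apply/(XfacesP _ ft).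
  by exists σ => //; apply: (ascent_refines H tE uE (si i) (pS _ (si i))).
rewrite -sumrN; apply: eq_bigr => f /(XfacesP _ ft)[σ rσ fE].
have [i si' ri] := refines_ascent ft H tE uE pS rσ.
have im : (i < (size l).-1)%N by rewrite ltn_predRL.
rewrite (big_pred1 (Ordinal im)) ?opprK // => m.
apply/idP/eqP => [/(XfacesP _ (fi m))[σ' rσ' fE']|->]; last first.
  by apply/(XfacesP _ (fi (Ordinal im))); exists σ.
have E : σ = σ'.
  have [_ sσ _ _ _] := rσ; have [_ sσ' _ _ _] := rσ'.
  by rewrite -(decr_seq_desc sσ) -(decr_seq_desc sσ') -fE -fE'.
rewrite -{}E in rσ'; apply: val_inj => /=.
have [mi|im'|//] := ltngtP m i.
  by case: (refines_disjoint ft H tE uE pS mi si' rσ' ri).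
by case: (refines_disjoint ft H tE uE pS im' (si m) ri rσ').
Qed.

(** * The fan *)

Lemma cone_simplicial (A : {set refl}) : indep rho A -> simplicial_cone (cone rho A).
Proof.
move=> /indepP fr; pose V := root_mx rho (size (enum A)) (enum A).
exists (size (enum A)), V; split; first exact: free_root_mx.
(* A default reflection for [nth] is available only when [A] is nonempty. *)
have [/eqP A0|/set0Pn[t0 _]] := boolP (A == finset.set0).
  apply/seteqP; split=> v [a a0 ->].
    exists 0; first by move=> i; rewrite mxE.
    by rewrite mul0mx big_pred0 // => t; rewrite A0 inE.
  have s0 : size (enum A) = 0%N by rewrite A0 enum_set0.
  rewrite mulmx_sum_row; apply: cone_sum => -[i ilt].
  by have := leq_trans ilt (eq_leq s0).
apply/seteqP; split=> v [a a0 ->].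
  exists (\row_i a (nth t0 (enum A) i)); first by move=> i; rewrite mxE.
  rewrite mulmx_sum_row -[LHS]big_enum [LHS](big_nth t0) [LHS]big_mkord.
  by apply: eq_bigr => i _; rewrite mxE row_root_mx (nth_map t0).
rewrite mulmx_sum_row; apply: cone_sum => i _; apply: coneZ => //.
rewrite row_root_mx (nth_map t0) //; apply: cone_root.
by rewrite -mem_enum mem_nth.
Qed.

Lemma cone_supporting (A : {set refl}) (w : 'rV[R]_n) :
  {in A, forall t, 0 <= dotv w (rho t)} ->
  (fun v => cone rho A v /\ dotv w v = 0)
    = cone rho [set t in A | dotv w (rho t) == 0]%SET.
Proof.
move=> wA; apply/seteqP; split=> v.
  move=> [[a a0 ->]]; rewrite dotv_sumr => /eqP.
  rewrite psumr_eq0 => [/allP H|t tA]; last by rewrite dotvZr mulr_ge0 ?wA.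
  apply: cone_sum => t tA; have := H t (mem_index_enum t); rewrite tA /= dotvZr mulf_eq0.
  case/orP=> [/eqP->|wt]; first by rewrite scale0r; apply: cone0.
  by apply: coneZ => //; apply: cone_root; rewrite inE tA.
move=> cv; split; first by apply: coneS cv; apply/fintype.subsetP => t /finset.setIdP[].
have [a _ ->] := cv; rewrite dotv_sumr big1 // => t /finset.setIdP[_ /eqP wt].
by rewrite dotvZr wt mulr0.
Qed.

Section Fan.
Variable ts : seq refl.
Hypothesis fts : fact ts.
Local Notation XX := (Xfaces rho c (in_tuple ts)).

(** Subsets of the faces are included because a fan contains all faces of its cones. *)
Definition refining_fan : set (set 'rV[R]_n) :=
  (cone rho @` (fun g : {set refl} => exists2 f, f \in XX & g \subset f))%classic.

Lemma Xfaces_clique f : f \in XX -> clique f.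
Proof. by move=> /(XfacesP _ fts)[σ [fσ sσ _ _ _] ->]; apply: desc_clique. Qed.

Lemma Xfaces_indep f : f \in XX -> indep rho f.
Proof.
move=> /(XfacesP _ fts)[σ [fσ _ _ _ _] ->]; apply: free_indep.
  exact: fact_uniq.
exact: fact_free.
Qed.

Lemma Xfaces_card f : f \in XX -> #|f| = size ts.
Proof.
by move=> /(XfacesP _ fts)[σ [fσ _ zσ _ _] ->]; rewrite set_seq_card ?fact_uniq.
Qed.

(** The supporting form takes the value 0 on the roots of [g] that belong to [g'] and 1 on the
    others; by [clique_cap] the face it cuts out is the intersection. *)
Lemma cone_face_cap (f g g' : {set refl}) : f \in XX -> g \subset f -> clique g' ->
  cone_face (setI (cone rho g) (cone rho g')) (cone rho g).
Proof.
move=> fX gf cg'; have cg := cliqueS gf (Xfaces_clique fX).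
have [σ [fσ _ _ _ _] fE] := (XfacesP _ fts).1 fX.
have [w wE] := dual_vector (fun t => (t \notin g')%:R) fσ.
have wg t : t \in g -> dotv w (rho t) = (t \notin g')%:R.
  by move=> tg; apply: wE; have := fintype.subsetP gf t tg; rewrite fE inE.
have w0 : {in g, forall t, 0 <= dotv w (rho t)} by move=> t /wg->; rewrite ler0n.
exists w; split.
  move=> v [a a0 ->]; rewrite dotv_sumr sumr_ge0 // => t tg.
  by rewrite dotvZr mulr_ge0 ?w0.
rewrite (cone_supporting w0).
have -> : [set t in g | dotv w (rho t) == 0]%SET = (g :&: g')%SET.
  apply/setP => t; rewrite !inE; case tg : (t \in g) => //=.
  by rewrite wg // pnatr_eq0 eqb0 negbK.
apply/seteqP; split=> v; first by move=> [vg vg']; apply: clique_cap.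
by move=> vgg'; split; apply: coneS vgg'; rewrite ?subsetIl ?subsetIr.
Qed.

Lemma refining_fan_simplicial : simplicial_fan refining_fan.
Proof.
split.
- by apply: finite_image; apply: finite_finset.
- move=> _ [g [f fX gf] <-]; apply: cone_simplicial.
  exact: indepS gf (Xfaces_indep fX).
- move=> _ D [g [f fX gf] <-] [w [w0 ->]]; rewrite cone_supporting; last first.
    by move=> t tg; apply: w0; apply: cone_root.
  exists [set t in g | dotv w (rho t) == 0]%SET => //; exists f => //.
  by apply: fintype.subset_trans gf; apply/fintype.subsetP => t /finset.setIdP[].
move=> _ _ [g [f fX gf] <-] [g' [f' fX' gf'] <-]; split.
  exact: (cone_face_cap fX gf (cliqueS gf' (Xfaces_clique fX'))).
by rewrite setIC; apply: (cone_face_cap fX' gf' (cliqueS gf (Xfaces_clique fX))).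
Qed.

(** The faces in [XX] all have the same cardinality, so none of their cones can lie strictly inside
    another cone of the fan. *)
Lemma refining_fan_maximal :
  maximal_cones refining_fan = (cone rho @` [set f | f \in XX])%classic.
Proof.
apply/seteqP; split=> C.
  move=> [[g [f fX gf] <-] gmax]; exists f => //; apply: gmax; last exact: coneS.
  by exists f => //; exists f.
move=> [f fX <-]; split; first by exists f => //; exists f.
move=> _ [g [f' fX' gf'] <-] sub; congr (cone rho _); apply/esym/eqP.
have card_le : (#|g| <= #|f|)%N.
  by rewrite (Xfaces_card fX) -(Xfaces_card fX') subset_leq_card.
rewrite eqEcard card_le andbT.
apply: clique_sub_cone sub; first exact: Xfaces_clique.
exact: cliqueS gf' (Xfaces_clique fX').
Qed.

Lemma refining_fan_support : fan_support refining_fan = cone rho [set t in ts]%SET.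
Proof.
apply/seteqP; split=> v.
  move=> [_ [g [f fX gf] <-] vg].
  have [σ [_ _ _ _ sub] fE] := (XfacesP _ fts).1 fX.
  by apply: sub; rewrite -fE; apply: coneS vg.
move=> vt; have [σ rσ vσ] := cover fts vt.
exists (cone rho [set t in σ]%SET) => //; exists [set t in σ]%SET => //.
by exists [set t in σ]%SET => //; apply/(XfacesP _ fts); exists σ.
Qed.

End Fan.

Lemma fan_and_expansion j (ts : j.-tuple refl) : NC rG c j (refl_prod ts) ->
  (exists F : set (set 'rV[R]_n),
    [/\ simplicial_fan F,
        maximal_cones F = (cone rho @` [set f | f \in Xfaces rho c ts])%classic
      & fan_support F = cone rho [set t in ts]%SET])
  /\
  \prod_(t <- ts) x_gen k c t
    = \sum_(f in Xfaces rho c ts) x_face k c prec f *~ omega rho prec ts f.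
Proof.
case: ts => ts sz; have := sz; move/eqP: (sz) => szE; subst j => sz'.
have -> : Tuple sz = in_tuple ts by apply: val_inj.
move=> fts; split; last exact: x_prod_expansion.
exists (refining_fan ts); split.
- exact: refining_fan_simplicial.
- exact: refining_fan_maximal.
- exact: refining_fan_support.
Qed.

End DualBraid.

Theorem theorem6p5 (R : realType) (k : fieldType) (n : nat)
  (gT : finGroupType) (rG : mx_representation R [set: gT]%g n)
  (faithfulW : mx_faithful rG)
  (generatedW : generated (reflections rG) = [set: gT]%SET)
  (h : 'rV[R]_n) (rho : refl rG -> 'rV[R]_n)
  (rhoP : positive_roots rho h)
  (s : n.-tuple (refl rG)) (s_uniq : uniq s)
  (s_simple : simple_system rho [set: refl rG]%SET [set t in s]%SET)
  (c : gT) (cE : c = refl_prod s)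
  (prec : rel (refl rG))
  (prec_refl : reflection_ordering rho [set t in s]%SET prec)
  (prec_compatible : c_compatible c prec)
  (j : nat) (ts : j.-tuple (refl rG))
  (tsP : NC rG c j (refl_prod ts)) :
  (exists F : set (set 'rV[R]_n),
    [/\ simplicial_fan F,
        maximal_cones F
          = (cone rho @` [set f | f \in Xfaces rho c ts])%classic
      & fan_support F = cone rho [set t in ts]%SET])
  /\
  \prod_(t <- ts) x_gen k c t
    = \sum_(f in Xfaces rho c ts) x_face k c prec f *~ omega rho prec ts f.
Proof.
exact: (fan_and_expansion faithfulW generatedW rhoP s_uniq s_simple cE prec_refl
  prec_compatible).
Qed.
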